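(* Let $X_h:\mathbb{S}^1\times[0,T]\to\mathbb{R}^2$, $X_h(\xi,t)=\sum_{j=1}^N X_j(t)\varphi_j(\xi)$, be a semidiscrete solution (as defined in the context) with convex initial data, i.e. such that $X_h(\cdot,0)=I_hX^0$ is a convex $N$-polygon, and with $q_j(t)>0$ for all $j$ and $t\in[0,T]$. Then the perimeter $L_h(t)=\sum_{j=1}^N|X_j(t)-X_{j-1}(t)|$ of the closed curve is decreasing, i.e. $$\frac{d}{dt}L_h\le 0 .$$
   Context: Let $\mathbb{S}^1=[0,2\pi]$ with endpoints identified, and let $0=\xi_0<\xi_1<\dots<\xi_N=2\pi$ be a partition, $N\ge 3$, $I_j=[\xi_{j-1},\xi_j]$, $h_j=\xi_j-\xi_{j-1}$, $h=\max_j h_j$. All indices are periodic modulo $N$. Let $V_h$ be the space of continuous periodic functions $v:\mathbb{S}^1\to\mathbb{R}^2$ that are affine on each $I_j$, let $\varphi_j$ be the scalar continuous periodic piecewise affine nodal basis function with $\varphi_j(\xi_i)=\delta_{ij}$, and for continuous $v:\mathbb{S}^1\to\mathbb{R}^2$ let $I_hv=\sum_{j=1}^N v(\xi_j)\varphi_j$. For $(a,b)\in\mathbb{R}^2$ put $(a,b)^\perp=(-b,a)$. $X^0:\mathbb{S}^1\to\mathbb{R}^2$ is a given initial curve. Semidiscrete solution: a function $X_h(\xi,t)=\sum_{j=1}^NX_j(t)\varphi_j(\xi)$ on $\mathbb{S}^1\times[0,T]$ with $X_h(\cdot,0)=I_hX^0$ satisfying, for all $v_h\in V_h$ and all $t$,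 $$\int_{\mathbb{S}^1}|\partial_\xi X_h|\,\partial_tX_h\cdot v_h\,d\xi+\int_{\mathbb{S}^1}\frac{\partial_\xi X_h}{|\partial_\xi X_h|}\cdot\partial_\xi v_h\,d\xi+\int_{\mathbb{S}^1}\frac{\mathbf{h}^2|\partial_\xi X_h|}{6}\,\partial_\xi\partial_tX_h\cdot\partial_\xi v_h\,d\xi+\int_{\mathbb{S}^1}\frac{2\pi}{L_h}(\partial_\xi X_h)^\perp\cdot v_h\,d\xi=0,$$ where $\mathbf{h}=h_j$ on $I_j$, $q_j=|X_j-X_{j-1}|$ and $L_h=\sum_{j=1}^Nq_j$ is the perimeter. Equivalently, the vertices satisfy the ODE system $$\frac{q_j+q_{j+1}}{2}\dot X_j=\frac{X_{j+1}-X_j}{q_{j+1}}-\frac{X_j-X_{j-1}}{q_j}-\frac{\pi}{L_h}(X_{j+1}-X_{j-1})^\perp,\qquad 1\le j\le N.$$ The image of $X_h(\cdot,t)$ is the closed polygonal curve with successive vertices $X_1(t),\dots,X_N(t)$. An $N$-polygon $(Y_1,\dots,Y_N)$ is a closed polygon with vertices $Y_j$ and edges $\overline{Y_{j-1}Y_j}$ having exactly $N$ sides, i.e. no three adjacent vertices are collinear. It is called convex if it is the boundary of a convex set. The vertices are listed in anticlockwise order along the polygon. *)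

(* Defs.v *)
From Stdlib Require Import Reals.
From Coquelicot Require Import Coquelicot.
Open Scope R_scope.

(* The plane is [R * R]; Coquelicot's [norm] on it is the Euclidean one. *)
Definition dot (u v : R * R) : R := fst u * fst v + snd u * snd v.
Definition perp (u : R * R) : R * R := (- snd u, fst u).

(* Functions on the circle are 2 PI-periodic functions on R. *)
Definition periodic_fun {V : Type} (f : R -> V) : Prop :=
  forall x, f (x + 2 * PI) = f x.

(* Families indexed modulo N are N-periodic families over nat, so that the
   index j - 1 only makes sense for 1 <= j and the index 0 stands for N. *)
Definition periodic_idx {V : Type} (N : nat) (Y : nat -> V) : Prop :=
  forall j, Y (j + N)%nat = Y j.

Definition is_partition (N : nat) (xi : nat -> R) : Prop :=
  xi 0%nat = 0 /\ xi N = 2 * PI /\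
  (forall j, (1 <= j <= N)%nat -> xi (j - 1)%nat < xi j).

Definition fe_space {V : NormedModule R_AbsRing} (N : nat) (xi : nat -> R)
    (v : R -> V) : Prop :=
  (forall x, continuous v x) /\ periodic_fun v /\
  (forall j, (1 <= j <= N)%nat -> exists a b : V,
     forall x, xi (j - 1)%nat <= x <= xi j -> v x = plus a (scal x b)).

Definition is_nodal_basis (N : nat) (xi : nat -> R) (phi : nat -> R -> R) : Prop :=
  forall j, (1 <= j <= N)%nat ->
    fe_space (V := R_NormedModule) N xi (phi j) /\
    (forall i, (1 <= i <= N)%nat -> phi j (xi i) = if Nat.eqb i j then 1 else 0).

Definition fe_comb (N : nat) (phi : nat -> R -> R) (c : nat -> R * R) (x : R) : R * R :=
  sum_n_m (fun j => scal (phi j x) (c j)) 1 N.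

Definition interp (N : nat) (xi : nat -> R) (phi : nat -> R -> R)
    (v : R -> R * R) : R -> R * R :=
  fe_comb N phi (fun j => v (xi j)).

(* The function equal to h_j = xi_j - xi_(j-1) on the j-th element of
   (0, 2 PI]; its values at the nodes do not affect integrals. *)
Definition mesh_fun (N : nat) (xi : nat -> R) (x : R) : R :=
  sum_n_m (fun j =>
    if Rlt_dec (xi (j - 1)%nat) x then
      if Rle_dec x (xi j) then xi j - xi (j - 1)%nat else 0
    else 0) 1 N.

(* For piecewise affine f this is the derivative in the interior of each
   element; the values of the total function [Derive] at the finitely many
   nodes are irrelevant to the integrals below. *)
Definition dxi (f : R -> R * R) (x : R) : R * R :=
  (Derive (fun y => fst (f y)) x, Derive (fun y => snd (f y)) x).

Definition unit_vec (u : R * R) : R * R := scal (/ norm u) u.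

Definition edge_length (Y : nat -> R * R) (j : nat) : R :=
  norm (minus (Y j) (Y (j - 1)%nat)).
Definition perimeter (N : nat) (Y : nat -> R * R) : R :=
  sum_n_m (fun j => edge_length Y j) 1 N.

(* l is the derivative at t of f restricted to [0, T]: one-sided at the two
   end points, the usual derivative for 0 < t < T. *)
Definition is_derive_on {V : NormedModule R_AbsRing} (T : R) (f : R -> V)
    (t : R) (l : V) : Prop :=
  filterdiff f (within (fun s => 0 <= s <= T) (locally t)) (fun s => scal s l).

(* X j t is the vertex X_j(t); dtX is the time derivative of the function
   X_h(x, t) = sum_j X_j(t) phi_j(x). *)
Definition semidiscrete_solution (N : nat) (xi : nat -> R) (phi : nat -> R -> R)
    (X0 : R -> R * R) (T : R) (X : nat -> R -> R * R) : Prop :=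
  let Xh := fun x t => fe_comb N phi (fun j => X j t) x in
  let Lh := fun t => perimeter N (fun j => X j t) in
  (forall t, periodic_idx N (fun j => X j t)) /\
  (forall x, Xh x 0 = interp N xi phi X0 x) /\
  exists dtX : R -> R -> R * R,
    (forall x t, 0 <= t <= T -> is_derive_on T (Xh x) t (dtX x t)) /\
    (forall t, 0 <= t <= T -> forall v : R -> R * R, fe_space N xi v ->
       let DX := dxi (fun y => Xh y t) in
       let DdtX := dxi (fun y => dtX y t) in
       RInt (fun x => norm (DX x) * dot (dtX x t) (v x)) 0 (2 * PI)
       + RInt (fun x => dot (unit_vec (DX x)) (dxi v x)) 0 (2 * PI)
       + RInt (fun x => mesh_fun N xi x ^ 2 * norm (DX x) / 6
                          * dot (DdtX x) (dxi v x)) 0 (2 * PI)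
       + RInt (fun x => 2 * PI / Lh t * dot (perp (DX x)) (v x)) 0 (2 * PI)
       = 0).

Definition segment (a b p : R * R) : Prop :=
  exists s, 0 <= s <= 1 /\ p = plus a (scal s (minus b a)).

Definition collinear (a b c : R * R) : Prop :=
  exists (p d : R * R) (s1 s2 s3 : R),
    a = plus p (scal s1 d) /\ b = plus p (scal s2 d) /\ c = plus p (scal s3 d).

Definition polygon (N : nat) (Y : nat -> R * R) (p : R * R) : Prop :=
  exists j, (1 <= j <= N)%nat /\ segment (Y (j - 1)%nat) (Y j) p.

Definition convex_set (K : R * R -> Prop) : Prop :=
  forall a b p, K a -> K b -> segment a b p -> K p.

Definition boundary (K : R * R -> Prop) (p : R * R) : Prop :=
  ~ locally p K /\ ~ locally p (fun q => ~ K q).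

(* Seen from some point c, the polar angle of the running point increases
   along every edge, by 2 PI altogether. This makes the vertices run once,
   and anticlockwise, around the polygon; it excludes a curve traversed
   several times, which would have fewer than N sides. *)
Definition anticlockwise (N : nat) (Y : nat -> R * R) : Prop :=
  exists (c : R * R) (r alpha : nat -> R),
    (forall j, (j <= N)%nat ->
       0 < r j /\ Y j = plus c (scal (r j) (cos (alpha j), sin (alpha j)))) /\
    (forall j, (1 <= j <= N)%nat -> 0 < alpha j - alpha (j - 1)%nat < PI) /\
    alpha N = alpha 0%nat + 2 * PI.

Definition convex_N_polygon (N : nat) (Y : nat -> R * R) : Prop :=
  (forall j, (1 <= j <= N)%nat -> ~ collinear (Y (j - 1)%nat) (Y j) (Y (j + 1)%nat)) /\
  anticlockwise N Y /\
  (exists K, convex_set K /\ forall p, polygon N Y p <-> boundary K p).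

(* Main.v *)
Require Import Defs.
From Stdlib Require Import Reals Lra Lia Psatz Wf_nat Classical FunctionalExtensionality.
From Coquelicot Require Import Coquelicot.
Open Scope R_scope.

(** Write [T_k] for the unit tangents of the edges, [q_k] for their lengths,
    [w_k = (q_k + q_(k+1)) / 2], [L] for the perimeter and [th_k] for the angle
    from [T_k] to [T_(k+1)].

    The perimeter decreases at every instant at which all [th_k] are in
    [0, PI] and add up to [2 PI]. Summation by parts and the vertex equations
    give
      [- dL/dt = sum_k ((2 - 2 cos th_k) / w_k - (2 PI / L) sin th_k)].
    With [a = th_k / 2] and [2 - 2 cos th_k = (2 sin a)^2], the square is
    bounded below by its tangent line at the value [2 PI w_k / L]; then
    [a + sin a cos a <= 2 sin a] on [0, PI / 2] shows that the term is at least
    [(2 PI / L) th_k - 4 PI^2 w_k / L^2] ([dissipation_term]). As the [w_k] add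
    up to [L], these lower bounds add up to zero ([perimeter_rate_le0]).

    It remains to see that the angles keep this property. For a convex polygon
    traversed once, all of them are in (0, PI) and their sum is [2 PI]
    ([convex_polygon_turns]). Differentiating the tangents, the vertex equations
    yield [d th_k / dt >= - C th_k] as long as the neighbouring angles are in
    [0, PI] ([turn_rate_lower_bound]), so an angle cannot reach zero in finite
    time; and the sum is constant, since its derivative telescopes. If an angle
    reached PI, all other edges would lie on one side of the line of one edge
    and the polygon could not close ([turn_angle_lt_PI]). So the set of times
    at which all angles are in (0, PI) is open and closed in [0, T]
    ([turn_sin_stays_positive]).

    The vertex equations come from the weak form: the term with the squared
    mesh size lumps the mass matrix, and testing with the finite element
    function whose nodal values are the residuals makes the residuals vanish
    ([vertex_ode_of_weak_form]). One-sided derivatives at the ends of the time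
    interval are reduced to ordinary ones by continuing the vertices along
    their tangents ([is_derive_extend]). *)

(** * Plane vectors *)

Definition cross (u v : R * R) : R := fst u * snd v - snd u * fst v.

Lemma norm_pair (u : R * R) : norm u = sqrt (dot u u).
Proof.
  change (norm u) with (prod_norm (K := R_AbsRing) u).
  unfold prod_norm, dot; f_equal.
  change (Rabs (fst u) ^ 2 + Rabs (snd u) ^ 2 = fst u * fst u + snd u * snd u).
  rewrite !pow2_abs; ring.
Qed.

Lemma dot_self_ge0 (u : R * R) : 0 <= dot u u.
Proof. unfold dot; nra. Qed.

Lemma norm_pair_sq (u : R * R) : norm u * norm u = dot u u.
Proof. rewrite norm_pair; apply sqrt_sqrt, dot_self_ge0. Qed.

Lemma unit_vec_scaled (u : R * R) :
  0 < norm u -> u = scal (norm u) (unit_vec u).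
Proof.
  intros Hu; destruct u as [a b]; unfold unit_vec.
  set (n := norm (a, b)) in *.
  change ((a, b) = (n * (/ n * a), n * (/ n * b))).
  f_equal; field; lra.
Qed.

Lemma norm_scal_pos (c : R) (u : R * R) : 0 < c -> norm (scal c u) = c * norm u.
Proof.
  intros Hc; rewrite !norm_pair.
  replace (dot (scal c u) (scal c u)) with (c * c * dot u u)
    by (destruct u; unfold dot; cbn; ring).
  rewrite sqrt_mult by (try apply dot_self_ge0; nra).
  rewrite sqrt_square by lra; reflexivity.
Qed.

Lemma unit_vec_scal_pos (c : R) (u : R * R) :
  0 < c -> 0 < norm u -> unit_vec (scal c u) = unit_vec u.
Proof.
  intros Hc Hu; unfold unit_vec; rewrite norm_scal_pos by exact Hc.
  revert Hu; generalize (norm u); intros n Hu.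
  apply injective_projections; cbn; field; lra.
Qed.

Lemma unit_vec_unit (u : R * R) :
  0 < norm u -> dot (unit_vec u) (unit_vec u) = 1.
Proof.
  intros Hu; pose proof (norm_pair_sq u) as H; destruct u as [a b].
  unfold unit_vec; set (n := norm (a, b)) in *.
  change (dot (/ n * a, / n * b) (/ n * a, / n * b) = 1).
  unfold dot in *; simpl in *.
  replace (/ n * a * (/ n * a) + / n * b * (/ n * b))
    with ((a * a + b * b) / (n * n)) by (field; lra).
  rewrite <- H; field; lra.
Qed.

Lemma cross_unit_vec (u v : R * R) :
  cross (unit_vec u) (unit_vec v) = / norm u * / norm v * cross u v.
Proof.
  destruct u as [a b], v as [c d]; unfold unit_vec.
  set (n := norm (a, b)); set (m := norm (c, d)).
  change (cross (/ n * a, / n * b) (/ m * c, / m * d)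
          = / n * / m * cross (a, b) (c, d)).
  unfold cross; simpl; ring.
Qed.

Lemma lagrange_unit (u v : R * R) :
  dot u u = 1 -> dot v v = 1 ->
  dot u v * dot u v + cross u v * cross u v = 1.
Proof.
  unfold dot, cross; intros Hu Hv.
  transitivity ((fst u * fst u + snd u * snd u) * (fst v * fst v + snd v * snd v)).
  - ring.
  - rewrite Hu, Hv; ring.
Qed.

Lemma dot_unit_bound (u v : R * R) :
  dot u u = 1 -> dot v v = 1 -> -1 <= dot u v <= 1.
Proof.
  intros Hu Hv; pose proof (lagrange_unit u v Hu Hv); split; nra.
Qed.

(** Expanding [u] and [w] in the orthonormal frame of a unit vector [v]: with
    [cross_compose] these are the addition formulas of cosine and sine. *)
Lemma dot_compose (u v w : R * R) :
  dot v v = 1 ->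
  dot u w = dot u v * dot v w - cross u v * cross v w.
Proof.
  intros Hv; transitivity (dot v v * dot u w); [rewrite Hv; ring|].
  unfold dot, cross; ring.
Qed.

Lemma cross_compose (u v w : R * R) :
  dot v v = 1 ->
  cross u w = cross u v * dot v w + dot u v * cross v w.
Proof.
  intros Hv; transitivity (dot v v * cross u w); [rewrite Hv; ring|].
  unfold dot, cross; ring.
Qed.

(** * Angles *)

Definition angle (u v : R * R) : R := acos (dot u v).

Lemma cos_angle (u v : R * R) :
  dot u u = 1 -> dot v v = 1 -> cos (angle u v) = dot u v.
Proof. intros; apply cos_acos, dot_unit_bound; assumption. Qed.

Lemma sin_angle (u v : R * R) :
  dot u u = 1 -> dot v v = 1 -> 0 <= cross u v -> sin (angle u v) = cross u v.
Proof.
  intros Hu Hv Hc; unfold angle.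
  rewrite sin_acos by (apply dot_unit_bound; assumption).
  rewrite <- (sqrt_Rsqr (cross u v)) by assumption.
  f_equal; unfold Rsqr; pose proof (lagrange_unit u v Hu Hv); lra.
Qed.

Lemma angle_bounds (u v : R * R) : 0 <= angle u v <= PI.
Proof. apply acos_bound. Qed.

Lemma angle_interior (u v : R * R) :
  dot u u = 1 -> dot v v = 1 -> 0 < cross u v -> 0 < angle u v < PI.
Proof.
  intros Hu Hv Hc; pose proof (angle_bounds u v) as Hb.
  pose proof (sin_angle u v Hu Hv (Rlt_le _ _ Hc)) as Hs.
  split; (apply Rnot_le_lt; intros Hn).
  - replace (angle u v) with 0 in Hs by lra; rewrite sin_0 in Hs; lra.
  - replace (angle u v) with PI in Hs by lra; rewrite sin_PI in Hs; lra.
Qed.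

(** The sum of the two angles has the cosine of [angle u w] and a positive
    sine, hence lies in the range of the arc cosine. *)
Lemma angle_add (u v w : R * R) :
  dot u u = 1 -> dot v v = 1 -> dot w w = 1 ->
  0 < cross u v -> 0 < cross v w -> 0 < cross u w ->
  angle u w = angle u v + angle v w.
Proof.
  intros Hu Hv Hw Huv Hvw Huw.
  pose proof (angle_interior u v Hu Hv Huv) as B1.
  pose proof (angle_interior v w Hv Hw Hvw) as B2.
  assert (Hc : cos (angle u v + angle v w) = dot u w).
  { rewrite cos_plus, !cos_angle, !sin_angle by (assumption || lra).
    symmetry; apply dot_compose, Hv. }
  assert (Hs : sin (angle u v + angle v w) = cross u w).
  { rewrite sin_plus, !cos_angle, !sin_angle by (assumption || lra).
    symmetry; apply cross_compose, Hv. }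
  unfold angle at 1; rewrite <- Hc; apply acos_cos; split; [lra|].
  apply Rnot_lt_le; intros Hn.
  pose proof (sin_lt_0 (angle u v + angle v w) Hn ltac:(lra)); lra.
Qed.

Lemma ex_derive_continuity_pt (f : R -> R) (x : R) :
  ex_derive f x -> continuity_pt f x.
Proof.
  intros H; apply continuity_pt_filterlim.
  exact (ex_derive_continuous f x H).
Qed.

(** Equality at [a = 0], and the difference has the derivative
    [2 cos a (1 - cos a)]. *)
Lemma half_angle_bound (a : R) :
  0 <= a <= PI / 2 -> a + sin a * cos a <= 2 * sin a.
Proof.
  intros Ha.
  destruct (MVT_gen (fun x => 2 * sin x - x - sin x * cos x) 0 a
              (fun x => 2 * cos x * (1 - cos x))) as [c [Hc E]].
  - intros x _; auto_derive; [trivial|].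
    pose proof (sin2_cos2 x) as H; unfold Rsqr in H; nra.
  - intros x _; apply ex_derive_continuity_pt; auto_derive; trivial.
  - rewrite Rmin_left, Rmax_right in Hc by lra.
    pose proof (cos_ge_0 c ltac:(lra) ltac:(lra)); pose proof (COS_bound c).
    rewrite sin_0, Rminus_0_r in E.
    assert (0 <= 2 * cos c * (1 - cos c) * a).
    { apply Rmult_le_pos; [apply Rmult_le_pos; lra | lra]. }
    lra.
Qed.

(** The square of [2 sin (th / 2)] is bounded below by its tangent line at
    [2 PI w / L], the length that this chord of the tangent indicatrix has, up
    to higher order, on a fine regular polygon; [half_angle_bound] compares the
    remaining functions of the angle. *)
Lemma dissipation_term (L w th : R) :
  0 < L -> 0 < w -> 0 <= th <= PI ->
  2 * PI / L * th - 4 * PI * PI / (L * L) * w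
    <= (2 - 2 * cos th) / w - 2 * PI / L * sin th.
Proof.
  intros HL Hw Hth; set (a := th / 2).
  replace th with (2 * a) by (unfold a; field).
  rewrite cos_2a_sin, sin_2a.
  pose proof (half_angle_bound a ltac:(unfold a; lra)) as H.
  set (s := sin a) in *; set (c := cos a) in *; set (l := 2 * PI / L).
  assert (Hl : 0 < l).
  { apply Rdiv_lt_0_compat; [pose proof PI_RGT_0; lra | exact HL]. }
  replace (4 * PI * PI / (L * L) * w) with (l * l * w) by (unfold l; field; lra).
  assert (Hq : 4 * s * s / w >= 4 * l * s - l * l * w).
  { apply Rle_ge, Rmult_le_reg_r with w; [exact Hw|].
    replace (4 * s * s / w * w) with (4 * s * s) by (field; lra).
    pose proof (Rle_0_sqr (2 * s - l * w)) as Hsq; unfold Rsqr in Hsq; nra. }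
  replace ((2 - 2 * (1 - 2 * s * s)) / w) with (4 * s * s / w) by (field; lra).
  nra.
Qed.

(** * Sums over a period *)

(** [sum_n_m] with the type of its value folded to [R], on which [ring] and
    [lra] depend. *)
Definition sum1 (f : nat -> R) (n : nat) : R := sum_n_m f 1 n.

Lemma sum1_0 (f : nat -> R) : sum1 f 0 = 0.
Proof. apply (sum_n_m_zero (G := R_AbelianMonoid)); lia. Qed.

Lemma sum1_S (f : nat -> R) n : sum1 f (S n) = sum1 f n + f (S n).
Proof. apply (sum_n_Sm (G := R_AbelianMonoid)); lia. Qed.

Lemma sum1_ext (f g : nat -> R) n :
  (forall k, (1 <= k <= n)%nat -> f k = g k) -> sum1 f n = sum1 g n.
Proof. intros H; apply sum_n_m_ext_loc, H. Qed.

Lemma sum1_plus (f g : nat -> R) n :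
  sum1 (fun k => f k + g k) n = sum1 f n + sum1 g n.
Proof. apply (sum_n_m_plus (G := R_AbelianMonoid)). Qed.

Lemma sum1_scal (a : R) (f : nat -> R) n :
  sum1 (fun k => a * f k) n = a * sum1 f n.
Proof. apply (sum_n_m_mult_l (K := R_Ring)). Qed.

Lemma sum1_minus (f g : nat -> R) n :
  sum1 (fun k => f k - g k) n = sum1 f n - sum1 g n.
Proof.
  transitivity (sum1 (fun k => f k + (-1) * g k) n);
    [apply sum1_ext; intros k _; ring|].
  rewrite sum1_plus, sum1_scal; ring.
Qed.

Lemma sum1_le (f g : nat -> R) n :
  (forall k, (1 <= k <= n)%nat -> f k <= g k) -> sum1 f n <= sum1 g n.
Proof.
  induction n as [|n IH]; intros H.
  - rewrite !sum1_0; lra.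
  - rewrite !sum1_S; apply Rplus_le_compat; [apply IH; intros; apply H; lia|].
    apply H; lia.
Qed.

Lemma sum1_ge0 (f : nat -> R) n :
  (forall k, (1 <= k <= n)%nat -> 0 <= f k) -> 0 <= sum1 f n.
Proof.
  intros H; replace 0 with (sum1 (fun _ => 0) n) by apply (sum_n_m_const_zero (G := R_AbelianMonoid)).
  apply sum1_le, H.
Qed.

Lemma sum1_ge_term (f : nat -> R) n k :
  (forall i, (1 <= i <= n)%nat -> 0 <= f i) -> (1 <= k <= n)%nat ->
  f k <= sum1 f n.
Proof.
  induction n as [|n IH]; intros H Hk; [lia|].
  rewrite sum1_S.
  destruct (Nat.eq_dec k (S n)) as [->|Hn].
  - pose proof (sum1_ge0 f n ltac:(intros; apply H; lia)); lra.
  - pose proof (IH ltac:(intros; apply H; lia) ltac:(lia)).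
    pose proof (H (S n) ltac:(lia)); lra.
Qed.

Lemma sum1_shift (N : nat) (f : nat -> R) (m : nat) :
  periodic_idx N f ->
  sum1 (fun k => f (m + k)%nat) N = sum1 f N.
Proof.
  intros Hf; induction m as [|m IH]; [reflexivity|].
  rewrite <- IH, <- Rminus_0_r, <- (Rminus_diag (f (S m))).
  (* moving the window by one trades its first term for the
     one just after its end *)
  assert (H : forall n, sum1 (fun k => f (S m + k)%nat) n
      = sum1 (fun k => f (m + k)%nat) n + f (S m + n)%nat - f (S m)).
  { induction n as [|n IHn].
    - rewrite !sum1_0, Nat.add_0_r; ring.
    - rewrite !sum1_S, IHn.
      replace (m + S n)%nat with (S m + n)%nat by lia; ring. }
  rewrite H, Hf; ring.
Qed.

Lemma sum1_succ (N : nat) (f : nat -> R) :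
  periodic_idx N f -> sum1 (fun k => f (S k)) N = sum1 f N.
Proof. apply (sum1_shift N f 1). Qed.

Lemma sum1_pred (N : nat) (f : nat -> R) :
  periodic_idx N f -> sum1 (fun k => f (k - 1)%nat) N = sum1 f N.
Proof.
  intros Hf; destruct N as [|n]; [rewrite !sum1_0; reflexivity|].
  rewrite <- (sum1_shift (S n) f n) by exact Hf.
  apply sum1_ext; intros k Hk; rewrite <- Hf; f_equal; lia.
Qed.

Lemma sum1_single (f : nat -> R) (n i : nat) :
  (1 <= i <= n)%nat ->
  (forall k, (1 <= k <= n)%nat -> k <> i -> f k = 0) -> sum1 f n = f i.
Proof.
  induction n as [|n IH]; intros Hi H; [lia|].
  rewrite sum1_S; destruct (Nat.eq_dec i (S n)) as [->|Hn].
  - rewrite (sum1_ext f (fun k => 0 * f k)) by (intros; rewrite H by lia; ring).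
    rewrite sum1_scal; ring.
  - rewrite IH by (lia || (intros; apply H; lia)).
    rewrite (H (S n)) by lia; ring.
Qed.

Lemma sum1_nonneg_eq0 (f : nat -> R) (n : nat) :
  (forall k, (1 <= k <= n)%nat -> 0 <= f k) -> sum1 f n = 0 ->
  forall k, (1 <= k <= n)%nat -> f k = 0.
Proof.
  intros H0 Hs k Hk; pose proof (sum1_ge_term f n k H0 Hk); pose proof (H0 k Hk); lra.
Qed.

Lemma periodic_reduce {V : Type} (N : nat) (f : nat -> V) (k : nat) :
  (1 <= N)%nat -> periodic_idx N f ->
  exists j, (1 <= j <= N)%nat /\ f k = f j.
Proof.
  intros HN Hf; induction k as [k IH] using lt_wf_ind.
  destruct (Nat.le_gt_cases k N) as [H|H].
  - destruct k as [|k].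
    + exists N; split; [lia|]. exact (eq_sym (Hf 0%nat)).
    + exists (S k); split; [lia | reflexivity].
  - destruct (IH (k - N)%nat ltac:(lia)) as [j [Hj E]].
    exists j; split; [exact Hj|]. rewrite <- E, <- (Hf (k - N)%nat); f_equal; lia.
Qed.

Lemma periodic_reduce_lt {V : Type} (N : nat) (f : nat -> V) (k : nat) :
  (1 <= N)%nat -> periodic_idx N f -> exists j, (j < N)%nat /\ f k = f j.
Proof.
  intros HN Hf; destruct (periodic_reduce N f k HN Hf) as [j [Hj E]].
  destruct (Nat.eq_dec j N) as [->|Hn].
  - exists 0%nat; split; [lia|]; rewrite E; exact (Hf 0%nat).
  - exists j; split; [lia | exact E].
Qed.

(** * Closed polygons *)

Definition edge (Y : nat -> R * R) (k : nat) : R * R := minus (Y (S k)) (Y k).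
Definition edge_len (Y : nat -> R * R) (k : nat) : R := norm (edge Y k).
Definition tangent (Y : nat -> R * R) (k : nat) : R * R := unit_vec (edge Y k).
Definition turn_sin (Y : nat -> R * R) (k : nat) : R :=
  cross (tangent Y k) (tangent Y (S k)).
Definition turn_angle (Y : nat -> R * R) (k : nat) : R :=
  angle (tangent Y k) (tangent Y (S k)).

Lemma edge_periodic (N : nat) (Y : nat -> R * R) :
  periodic_idx N Y -> periodic_idx N (edge Y).
Proof. intros HY j; unfold edge; rewrite HY, <- Nat.add_succ_l, HY; reflexivity. Qed.

Lemma edge_len_periodic (N : nat) (Y : nat -> R * R) :
  periodic_idx N Y -> periodic_idx N (edge_len Y).
Proof. intros HY j; unfold edge_len; rewrite (edge_periodic N Y HY); reflexivity. Qed.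

Lemma tangent_periodic (N : nat) (Y : nat -> R * R) :
  periodic_idx N Y -> periodic_idx N (tangent Y).
Proof. intros HY j; unfold tangent; rewrite (edge_periodic N Y HY); reflexivity. Qed.

Lemma turn_sin_periodic (N : nat) (Y : nat -> R * R) :
  periodic_idx N Y -> periodic_idx N (turn_sin Y).
Proof.
  intros HY j; unfold turn_sin.
  rewrite (tangent_periodic N Y HY), <- Nat.add_succ_l, (tangent_periodic N Y HY); reflexivity.
Qed.

Lemma turn_angle_periodic (N : nat) (Y : nat -> R * R) :
  periodic_idx N Y -> periodic_idx N (turn_angle Y).
Proof.
  intros HY j; unfold turn_angle.
  rewrite (tangent_periodic N Y HY), <- Nat.add_succ_l, (tangent_periodic N Y HY); reflexivity.
Qed.

Lemma perimeter_sum_edge_len (N : nat) (Y : nat -> R * R) :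
  periodic_idx N Y -> perimeter N Y = sum1 (edge_len Y) N.
Proof.
  intros HY; rewrite <- sum1_pred by apply edge_len_periodic, HY.
  apply sum1_ext; intros k Hk; unfold edge_length, edge_len, edge.
  replace (S (k - 1)) with k by lia; reflexivity.
Qed.

Lemma sum_edges_eq0 (N : nat) (Y : nat -> R * R) (u : R * R) (m : nat) :
  periodic_idx N Y -> sum1 (fun k => cross u (edge Y (m + k))) N = 0.
Proof.
  intros HY.
  assert (H : forall n, sum1 (fun k => cross u (edge Y (m + k))) n
                        = cross u (minus (Y (S m + n)%nat) (Y (S m)))).
  { induction n as [|n IH].
    - rewrite sum1_0, Nat.add_0_r; destruct u, (Y (S m)); unfold cross.
      cbn; ring.
    - rewrite sum1_S, IH; unfold edge.
      replace (m + S n)%nat with (S m + n)%nat by lia.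
      replace (S m + S n)%nat with (S (S m + n)) by lia.
      destruct u, (Y (S m)), (Y (S m + n)%nat), (Y (S (S m + n))); unfold cross.
      cbn; ring. }
  rewrite H, HY; destruct u, (Y (S m)); unfold cross; cbn; ring.
Qed.

Lemma edge_tangent (Y : nat -> R * R) (k : nat) :
  0 < edge_len Y k -> edge Y k = scal (edge_len Y k) (tangent Y k).
Proof. apply unit_vec_scaled. Qed.

Lemma tangent_unit (Y : nat -> R * R) (k : nat) :
  0 < edge_len Y k -> dot (tangent Y k) (tangent Y k) = 1.
Proof. apply unit_vec_unit. Qed.

(** If the polygon turned by PI at some vertex, all other edges would have
    directions in a closed half plane bounded by the line of this edge. Since
    every other turning angle is positive, one of them points strictly into
    the half plane, and the polygon could not close. *)
Lemma turn_angle_lt_PI (N : nat) (Y : nat -> R * R) :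
  (3 <= N)%nat -> periodic_idx N Y ->
  (forall k, 0 < edge_len Y k) ->
  (forall k, 0 <= turn_sin Y k) -> (forall k, 0 < turn_angle Y k) ->
  sum1 (turn_angle Y) N = 2 * PI ->
  forall k, turn_angle Y k < PI.
Proof.
  intros HN HY Hq Hs Hth Hsum k.
  apply Rnot_le_lt; intros Hk.
  pose (phi := fun m => sum1 (fun i => turn_angle Y (k + i)) m).
  assert (Hinc : forall m n, (m <= n)%nat -> phi m <= phi n).
  { intros m n H; induction H as [|n _ IH]; [lra|].
    unfold phi in *; rewrite sum1_S; pose proof (Hth (k + S n)%nat); lra. }
  (* [phi m] is the direction of the edge [S m + k] relative to the edge
     [S k]; the turn at [k] itself is the last one of the period *)
  assert (Hlast : phi (N - 1)%nat <= PI).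
  { assert (E : phi N = 2 * PI).
    { rewrite <- Hsum; apply sum1_shift, turn_angle_periodic, HY. }
    replace N with (S (N - 1)) in E at 1 by lia.
    unfold phi in *; rewrite sum1_S in E.
    replace (k + S (N - 1))%nat with (k + N)%nat in E by lia.
    rewrite (turn_angle_periodic N Y HY) in E; lra. }
  assert (Hdir : forall m,
    dot (tangent Y (S k)) (tangent Y (S (k + m))) = cos (phi m) /\
    cross (tangent Y (S k)) (tangent Y (S (k + m))) = sin (phi m)).
  { induction m as [|m [IHc IHs]].
    - unfold phi; rewrite sum1_0, cos_0, sin_0, Nat.add_0_r.
      split; [apply tangent_unit, Hq | unfold cross; ring].
    - replace (phi (S m)) with (phi m + turn_angle Y (S (k + m)))
        by (unfold phi; rewrite sum1_S; do 2 f_equal; lia).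
      replace (S (k + S m)) with (S (S (k + m))) by lia.
      rewrite cos_plus, sin_plus, <- IHc, <- IHs.
      unfold turn_angle.
      rewrite cos_angle, sin_angle by (apply tangent_unit, Hq || apply Hs).
      split; [apply dot_compose | apply cross_compose]; apply tangent_unit, Hq. }
  assert (Hterm : forall i, cross (tangent Y (S k)) (edge Y (k + S i))
                            = edge_len Y (S (k + i)) * sin (phi i)).
  { intros i; replace (k + S i)%nat with (S (k + i)) by lia.
    rewrite edge_tangent by apply Hq.
    rewrite <- (proj2 (Hdir i)).
    unfold cross; cbn; ring. }
  assert (Hpos : 0 < cross (tangent Y (S k)) (edge Y (k + 2))).
  { rewrite Hterm; apply Rmult_lt_0_compat; [apply Hq|].
    pose proof (Hinc 2%nat (N - 1)%nat ltac:(lia)).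
    unfold phi in *; rewrite !sum1_S, sum1_0 in *.
    pose proof (Hth (k + 1)%nat); pose proof (Hth (k + 2)%nat).
    apply sin_gt_0; lra. }
  pose proof (sum1_ge_term (fun i => cross (tangent Y (S k)) (edge Y (k + i))) N 2) as Hge.
  rewrite sum_edges_eq0 in Hge by exact HY.
  apply (Rlt_not_le _ _ Hpos), Hge; [|lia].
  intros i Hi; destruct i as [|i]; [lia|].
  rewrite Hterm; apply Rmult_le_pos; [apply Rlt_le, Hq|].
  apply sin_ge_0.
  - replace 0 with (phi 0%nat) by apply sum1_0; apply Hinc; lia.
  - apply Rle_trans with (2 := Hlast), Hinc; lia.
Qed.

(** * The vertex equations *)

(** [D] is the vector of vertex velocities at an instant at which the
    vertices are [Y]. *)
Definition vertex_ode (N : nat) (Y D : nat -> R * R) : Prop :=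
  forall k,
    scal ((edge_len Y k + edge_len Y (S k)) / 2) (D (S k))
    = minus (minus (tangent Y (S k)) (tangent Y k))
        (scal (PI / perimeter N Y) (perp (minus (Y (S (S k))) (Y k)))).

Section VertexEquations.
Variables (N : nat) (Y D : nat -> R * R).
Hypothesis HN : (3 <= N)%nat.
Hypothesis HY : periodic_idx N Y.
Hypothesis HD : periodic_idx N D.
Hypothesis Hq : forall k, 0 < edge_len Y k.
Hypothesis Hode : vertex_ode N Y D.

Let L := perimeter N Y.
Let q := edge_len Y.
Let T := tangent Y.
Let c k := dot (T k) (T (S k)).
Let s := turn_sin Y.
Let w k := (q k + q (S k)) / 2.

Lemma edge_len_le_perimeter (k : nat) : q k <= L.
Proof.
  unfold L; rewrite perimeter_sum_edge_len by exact HY.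
  destruct (periodic_reduce N q k ltac:(lia) (edge_len_periodic N Y HY)) as [j [Hj ->]].
  apply (sum1_ge_term q N j); [|exact Hj].
  intros; apply Rlt_le, Hq.
Qed.

Lemma perimeter_gt0 : 0 < L.
Proof. apply Rlt_le_trans with (1 := Hq 0%nat), (edge_len_le_perimeter 0). Qed.

Lemma half_lengths_gt0 (k : nat) : 0 < w k.
Proof. pose proof (Hq k); pose proof (Hq (S k)); unfold w, q; lra. Qed.

(** All that is used of the vertex equations are their projections on the
    tangents and normals of the two edges at a vertex. *)
Lemma vertex_ode_dot (k : nat) (u : R * R) :
  w k * dot (D (S k)) u
  = dot (T (S k)) u - dot (T k) u
    - PI / L * (q k * cross (T k) u + q (S k) * cross (T (S k)) u).
Proof.
  pose proof (Hode k) as H.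
  replace (minus (Y (S (S k))) (Y k)) with (plus (edge Y k) (edge Y (S k))) in H
    by (unfold edge; apply injective_projections; cbn; ring).
  rewrite !edge_tangent in H by apply Hq.
  fold q T L in H; fold (w k) in H.
  transitivity (dot (scal (w k) (D (S k))) u).
  - destruct (D (S k)); unfold dot; cbn; ring.
  - rewrite H; destruct (T k), (T (S k)), u; unfold dot, cross, perp; cbn; ring.
Qed.

Lemma tangent_unit_sq (k : nat) : dot (T k) (T k) = 1.
Proof. apply tangent_unit, Hq. Qed.

(** The component of the vertex velocity that shortens the polygon: the two
    edges that meet in the vertex pull with their unit tangents. *)
Lemma velocity_tangent_jump (k : nat) :
  dot (D (S k)) (T (S k)) - dot (D (S k)) (T k)
  = (2 - 2 * c k) / w k - 2 * PI / L * s k.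
Proof.
  pose proof (half_lengths_gt0 k) as Hw; pose proof perimeter_gt0 as HL.
  apply Rmult_eq_reg_l with (w k); [|lra].
  rewrite Rmult_minus_distr_l, !vertex_ode_dot, !tangent_unit_sq.
  replace (dot (T (S k)) (T k)) with (c k) by (unfold c, dot; ring).
  replace (cross (T (S k)) (T k)) with (- s k) by (unfold s, turn_sin, T, cross; ring).
  replace (cross (T k) (T k)) with 0 by (unfold cross; ring).
  replace (cross (T (S k)) (T (S k))) with 0 by (unfold cross; ring).
  fold (c k); change (cross (T k) (T (S k))) with (s k).
  unfold w in *; field; lra.
Qed.

(** The normal components relative to the two edges that meet in a vertex are
    written with [1 - c k], so that all terms but the common [2 PI / L] are
    nonnegative on a convex polygon; the constant cancels between the two ends
    of an edge. *)
Lemma velocity_across_first (k : nat) :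
  cross (T k) (D (S k)) = (s k + PI / L * q (S k) * (1 - c k)) / w k - 2 * PI / L.
Proof.
  pose proof (half_lengths_gt0 k) as Hw; pose proof perimeter_gt0 as HL.
  apply Rmult_eq_reg_l with (w k); [|lra].
  replace (cross (T k) (D (S k))) with (dot (D (S k)) (perp (T k)))
    by (unfold cross, dot, perp; cbn; ring).
  rewrite vertex_ode_dot.
  replace (dot (T (S k)) (perp (T k))) with (s k)
    by (unfold s, turn_sin, T, cross, dot, perp; cbn; ring).
  replace (dot (T k) (perp (T k))) with 0 by (unfold dot, perp; cbn; ring).
  replace (cross (T k) (perp (T k))) with (dot (T k) (T k))
    by (unfold cross, dot, perp; cbn; ring).
  replace (cross (T (S k)) (perp (T k))) with (c k)
    by (unfold c, cross, dot, perp; cbn; ring).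
  rewrite tangent_unit_sq; unfold w in *; field; lra.
Qed.

Lemma velocity_across_second (k : nat) :
  cross (T (S k)) (D (S k)) = (s k + PI / L * q k * (1 - c k)) / w k - 2 * PI / L.
Proof.
  pose proof (half_lengths_gt0 k) as Hw; pose proof perimeter_gt0 as HL.
  apply Rmult_eq_reg_l with (w k); [|lra].
  replace (cross (T (S k)) (D (S k))) with (dot (D (S k)) (perp (T (S k))))
    by (unfold cross, dot, perp; cbn; ring).
  rewrite vertex_ode_dot.
  replace (dot (T k) (perp (T (S k)))) with (- s k)
    by (unfold s, turn_sin, T, cross, dot, perp; cbn; ring).
  replace (dot (T (S k)) (perp (T (S k)))) with 0 by (unfold dot, perp; cbn; ring).
  replace (cross (T (S k)) (perp (T (S k)))) with (dot (T (S k)) (T (S k)))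
    by (unfold cross, dot, perp; cbn; ring).
  replace (cross (T k) (perp (T (S k)))) with (c k)
    by (unfold c, cross, dot, perp; cbn; ring).
  rewrite tangent_unit_sq; unfold w in *; field; lra.
Qed.

(** * Dissipation *)

Definition angular_velocity (k : nat) : R :=
  cross (T k) (minus (D (S k)) (D k)) / q k.

(** After summation by parts the rate is minus a sum over vertices. By
    [dissipation_term] this sum is at least [(2 PI / L) (2 PI)] minus
    [(4 PI^2 / L^2) L], which is zero. *)
Lemma perimeter_rate_le0 :
  (forall k, 0 <= s k) -> sum1 (turn_angle Y) N = 2 * PI ->
  sum1 (fun k => dot (T k) (minus (D (S k)) (D k))) N <= 0.
Proof.
  intros Hs Hsum; pose proof perimeter_gt0 as HL.
  assert (E : sum1 (fun k => dot (T k) (minus (D (S k)) (D k))) N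
    = - sum1 (fun k => dot (D (S k)) (T (S k)) - dot (D (S k)) (T k)) N).
  { rewrite (sum1_minus (fun k => dot (D (S k)) (T (S k)))).
    rewrite (sum1_succ N (fun k => dot (D k) (T k))).
    - rewrite Ropp_minus_distr, <- sum1_minus.
      apply sum1_ext; intros k _; destruct (D (S k)), (D k), (T k).
      unfold dot; cbn; ring.
    - intros k; unfold T; rewrite HD, (tangent_periodic N Y HY); reflexivity. }
  rewrite E; apply Ropp_le_cancel; rewrite Ropp_0, Ropp_involutive.
  apply Rle_trans with
    (sum1 (fun k => 2 * PI / L * turn_angle Y k - 4 * PI * PI / (L * L) * w k) N).
  - rewrite sum1_minus, !sum1_scal, Hsum.
    assert (Hw : sum1 w N = L).
    { rewrite (sum1_ext w (fun k => / 2 * q k + / 2 * q (S k)))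
        by (intros; unfold w; field).
      rewrite sum1_plus, !sum1_scal, (sum1_succ N q) by apply edge_len_periodic, HY.
      unfold L, q; rewrite perimeter_sum_edge_len by exact HY; field. }
    rewrite Hw; right; field; lra.
  - apply sum1_le; intros k _; rewrite velocity_tangent_jump.
    replace (c k) with (cos (turn_angle Y k)) by (apply cos_angle; apply tangent_unit_sq).
    replace (s k) with (sin (turn_angle Y k))
      by (apply sin_angle; [apply tangent_unit_sq .. | apply Hs]).
    apply dissipation_term; [exact HL | apply half_lengths_gt0 | apply angle_bounds].
Qed.

(** A small turning angle is pushed up by its neighbours, and its own
    contribution to its rate of change is at worst proportional to it. *)
Lemma turn_rate_lower_bound (k : nat) :
  (forall j, 0 <= s j) ->
  - ((2 + 2 * PI) / (q (S k) * q (S (S k)))) * turn_angle Y (S k)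
    <= angular_velocity (S (S k)) - angular_velocity (S k).
Proof.
  intros Hs; pose proof perimeter_gt0 as HL; pose proof PI_RGT_0 as HPI.
  set (a := q (S k)); set (b := q (S (S k))); set (th := turn_angle Y (S k)).
  assert (Ha : 0 < a) by apply Hq; assert (Hb : 0 < b) by apply Hq.
  pose proof (edge_len_le_perimeter (S k) : a <= L) as HaL.
  pose proof (edge_len_le_perimeter (S (S k)) : b <= L) as HbL.
  assert (Hneigh : forall j, 0 <= (s j + PI / L * q j * (1 - c j)) / w j /\
                             0 <= (s j + PI / L * q (S j) * (1 - c j)) / w j).
  { intros j.
    pose proof (half_lengths_gt0 j); pose proof (Hs j).
    pose proof (dot_unit_bound _ _ (tangent_unit_sq j) (tangent_unit_sq (S j))) as Hc.
    assert (HP : 0 < PI / L) by (apply Rdiv_lt_0_compat; assumption).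
    split; (apply Rdiv_le_0_compat; [|assumption]); apply Rplus_le_le_0_compat;
      try assumption; (apply Rmult_le_pos; [|unfold c; lra]);
      apply Rmult_le_pos; try lra; apply Rlt_le, Hq. }
  (* only the vertex between the two edges contributes with a bad sign *)
  set (A := (s (S k) + PI / L * b * (1 - c (S k))) / w (S k)).
  set (B := (s (S k) + PI / L * a * (1 - c (S k))) / w (S k)).
  assert (H1 : angular_velocity (S k) <= A / a).
  { unfold angular_velocity; fold a; apply Rmult_le_compat_r;
      [apply Rlt_le, Rinv_0_lt_compat, Ha|].
    replace (cross (T (S k)) (minus (D (S (S k))) (D (S k))))
      with (cross (T (S k)) (D (S (S k))) - cross (T (S k)) (D (S k)))
      by (destruct (T (S k)), (D (S (S k))), (D (S k)); unfold cross; cbn; ring).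
    rewrite velocity_across_first, velocity_across_second.
    pose proof (proj1 (Hneigh k)); unfold A; fold b; lra. }
  assert (H2 : - B / b <= angular_velocity (S (S k))).
  { unfold angular_velocity; fold b; apply Rmult_le_compat_r;
      [apply Rlt_le, Rinv_0_lt_compat, Hb|].
    replace (cross (T (S (S k))) (minus (D (S (S (S k)))) (D (S (S k)))))
      with (cross (T (S (S k))) (D (S (S (S k)))) - cross (T (S (S k))) (D (S (S k))))
      by (destruct (T (S (S k))), (D (S (S (S k)))), (D (S (S k))); unfold cross; cbn; ring).
    rewrite velocity_across_first, velocity_across_second.
    pose proof (proj2 (Hneigh (S (S k)))); unfold B; fold a; lra. }
  assert (Hth : 0 <= th) by apply angle_bounds.
  assert (Hsin : s (S k) <= th).
  { replace (s (S k)) with (sin th)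
      by (apply sin_angle; [apply tangent_unit_sq .. | apply Hs]).
    destruct Hth as [Hth | <-]; [apply Rlt_le, sin_lt_x, Hth | rewrite sin_0; lra]. }
  assert (Hcos : 1 - c (S k) <= th).
  { replace (c (S k)) with (cos th) by (apply cos_angle; apply tangent_unit_sq).
    replace th with (2 * (th / 2)) at 1 by field; rewrite cos_2a_sin.
    assert (H0 : 0 <= sin (th / 2)).
    { apply sin_ge_0; [lra|]. pose proof (proj2 (angle_bounds (T (S k)) (T (S (S k))))).
      unfold th, turn_angle; fold T; lra. }
    pose proof (SIN_bound (th / 2)).
    assert (sin (th / 2) <= th / 2).
    { destruct Hth as [Hth | <-]; [apply Rlt_le, sin_lt_x; lra|].
      replace (0 / 2) with 0 by field; rewrite sin_0; lra. }
    nra. }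
  assert (Hc0 : 0 <= 1 - c (S k)).
  { pose proof (dot_unit_bound _ _ (tangent_unit_sq (S k)) (tangent_unit_sq (S (S k)))).
    unfold c; lra. }
  apply Rle_trans with (- B / b - A / a); [|lra].
  replace (- B / b - A / a)
    with (- ((2 * s (S k) + 2 * PI * ((a * a + b * b) / (L * (a + b))) * (1 - c (S k)))
             / (a * b)))
    by (unfold A, B, w; fold a b; field; lra).
  assert (Hr : (a * a + b * b) / (L * (a + b)) <= 1).
  { apply Rmult_le_reg_r with (L * (a + b)); [nra|].
    replace ((a * a + b * b) / (L * (a + b)) * (L * (a + b)))
      with (a * a + b * b) by (field; lra). nra. }
  assert (Hr0 : 0 <= (a * a + b * b) / (L * (a + b))).
  { apply Rdiv_le_0_compat; nra. }
  rewrite <- Ropp_mult_distr_l; apply Ropp_le_contravar.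
  replace ((2 + 2 * PI) / (a * b) * th) with ((2 * th + 2 * PI * th) / (a * b))
    by (field; lra).
  apply Rmult_le_compat_r; [apply Rlt_le, Rinv_0_lt_compat; nra|].
  set (r := (a * a + b * b) / (L * (a + b))) in *.
  assert (r * (1 - c (S k)) <= th) by nra.
  nra.
Qed.

End VertexEquations.

(** * Convex planar sets *)

(** Membership in the closure, in the form in which [boundary] provides it. *)
Definition adherent (K : R * R -> Prop) (p : R * R) : Prop :=
  ~ locally p (fun q => ~ K q).

Lemma ball_pair (p q : R * R) (e : R) :
  ball p e q <-> Rabs (fst q - fst p) < e /\ Rabs (snd q - snd p) < e.
Proof. reflexivity. Qed.

Lemma adherent_witness (K : R * R -> Prop) (p : R * R) (e : posreal) :
  adherent K p -> exists q, ball p e q /\ K q.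
Proof.
  intros H; apply NNPP; intros Hn; apply H; exists e; intros q Hq HK.
  apply Hn; exists q; split; assumption.
Qed.

Lemma Rabs_convex_comb_lt (x y s e : R) :
  0 <= s <= 1 -> Rabs x < e -> Rabs y < e -> Rabs (x + s * (y - x)) < e.
Proof.
  intros Hs Hx Hy.
  replace (x + s * (y - x)) with ((1 - s) * x + s * y) by ring.
  apply Rle_lt_trans with (Rmax (Rabs x) (Rabs y)); [|apply Rmax_lub_lt; assumption].
  eapply Rle_trans; [apply Rabs_triang|].
  rewrite !Rabs_mult, (Rabs_right (1 - s)), (Rabs_right s) by lra.
  pose proof (Rmax_l (Rabs x) (Rabs y)); pose proof (Rmax_r (Rabs x) (Rabs y)); nra.
Qed.

Lemma Rabs_dilation_lt (x y s e : R) :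
  0 <= s < 1 -> Rabs x < e * (1 - s) / 2 -> Rabs y < e * (1 - s) / 2 ->
  Rabs (/ (1 - s) * (x - s * y)) < e.
Proof.
  intros Hs Hx Hy; apply Rabs_def2 in Hx; apply Rabs_def2 in Hy.
  rewrite Rabs_mult, (Rabs_right (/ (1 - s))) by (apply Rle_ge, Rlt_le, Rinv_0_lt_compat; lra).
  apply Rmult_lt_reg_l with (1 - s); [lra|].
  rewrite <- Rmult_assoc, Rinv_r, Rmult_1_l by lra.
  apply Rabs_def1; nra.
Qed.

Lemma adherent_convex (K : R * R -> Prop) (a b p : R * R) :
  convex_set K -> adherent K a -> adherent K b -> segment a b p -> adherent K p.
Proof.
  intros HK Ha Hb [s [Hs ->]] [e He].
  destruct (adherent_witness K a e Ha) as [a' [Ba Ka]].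
  destruct (adherent_witness K b e Hb) as [b' [Bb Kb]].
  destruct (proj1 (ball_pair _ _ _) Ba) as [Ba1 Ba2], (proj1 (ball_pair _ _ _) Bb) as [Bb1 Bb2].
  apply (He (plus a' (scal s (minus b' a')))).
  - destruct a as [a1 a2], b as [b1 b2], a' as [c1 c2], b' as [d1 d2].
    apply ball_pair; cbn; split.
    + replace (_ - _) with ((c1 - a1) + s * ((d1 - b1) - (c1 - a1))) by ring.
      apply Rabs_convex_comb_lt; tauto.
    + replace (_ - _) with ((c2 - a2) + s * ((d2 - b2) - (c2 - a2))) by ring.
      apply Rabs_convex_comb_lt; tauto.
  - apply (HK a' b'); [assumption .. | exists s; split; [exact Hs | reflexivity]].
Qed.

(** A ball around [c] is contracted towards a point of [K] close to [m]; it
    stays in [K] and covers a neighbourhood of the point of the segment. *)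
Lemma interior_segment (K : R * R -> Prop) (c m : R * R) (s : R) :
  convex_set K -> locally c K -> adherent K m -> 0 <= s < 1 ->
  locally (plus c (scal s (minus m c))) K.
Proof.
  intros HK [e He] Hm Hs.
  assert (He2 : 0 < e * (1 - s) / 2) by (destruct e; cbn; nra).
  destruct (adherent_witness K m (mkposreal _ He2) Hm) as [m' [Bm Km]].
  destruct (proj1 (ball_pair _ _ _) Bm) as [Bm1 Bm2]; cbn [pos] in Bm1, Bm2.
  exists (mkposreal _ He2); intros p Bp; destruct (proj1 (ball_pair _ _ _) Bp) as [Bp1 Bp2]; cbn [pos] in Bp1, Bp2.
  pose (c' := scal (/ (1 - s)) (minus p (scal s m'))).
  apply (HK c' m').
  - apply He, ball_pair; unfold c'.
    destruct c as [c1 c2], m as [m1 m2], m' as [n1 n2], p as [p1 p2]; cbn in Bm1, Bm2, Bp1, Bp2 |- *.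
    split.
    + replace (_ - _) with (/ (1 - s) * ((p1 - (c1 + s * (m1 + - c1))) - s * (n1 - m1)))
        by (field; lra).
      apply Rabs_dilation_lt; tauto.
    + replace (_ - _) with (/ (1 - s) * ((p2 - (c2 + s * (m2 + - c2))) - s * (n2 - m2)))
        by (field; lra).
      apply Rabs_dilation_lt; tauto.
  - exact Km.
  - exists s; split; [lra|]; unfold c'; apply injective_projections; cbn; field; lra.
Qed.

(** * Convex polygons turn left, by 2 PI altogether *)

Lemma cross_scal (a b : R) (u v : R * R) :
  cross (scal a u) (scal b v) = a * b * cross u v.
Proof. destruct u, v; unfold cross; cbn; ring. Qed.

Lemma cross_gt0_norm (u v : R * R) : 0 < cross u v -> 0 < norm u /\ 0 < norm v.
Proof.
  intros H; rewrite !norm_pair; destruct u as [a b], v as [c d].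
  unfold cross, dot in *; cbn in *.
  split; apply sqrt_lt_R0; apply Rnot_le_lt; intros Hn.
  - assert (a = 0 /\ b = 0) as [-> ->] by (split; nra); lra.
  - assert (c = 0 /\ d = 0) as [-> ->] by (split; nra); lra.
Qed.

Lemma cross_unit_vec_gt0 (u v : R * R) :
  0 < cross u v -> 0 < cross (unit_vec u) (unit_vec v).
Proof.
  intros H; destruct (cross_gt0_norm u v H) as [Hu Hv]; rewrite cross_unit_vec.
  apply Rmult_lt_0_compat; [apply Rmult_lt_0_compat; apply Rinv_0_lt_compat|]; assumption.
Qed.

Lemma cross_polar (a b : R) : cross (cos a, sin a) (cos b, sin b) = sin (b - a).
Proof. unfold cross; cbn; rewrite sin_minus; ring. Qed.

Section ConvexPolygon.
Variables (N : nat) (Y : nat -> R * R).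
Hypothesis HN : (3 <= N)%nat.
Hypothesis HY : periodic_idx N Y.

Section Centre.
Variables (c : R * R) (r alpha : nat -> R).
Hypothesis Hr : forall j, (j <= N)%nat ->
  0 < r j /\ Y j = plus c (scal (r j) (cos (alpha j), sin (alpha j))).
Hypothesis Halpha : forall j, (1 <= j <= N)%nat -> 0 < alpha j - alpha (j - 1)%nat < PI.
Hypothesis Hturn : alpha N = alpha 0%nat + 2 * PI.

Let p k := minus (Y k) c.

Lemma spoke_polar (j : nat) :
  (j <= N)%nat -> p j = scal (r j) (cos (alpha j), sin (alpha j)).
Proof.
  intros Hj; unfold p; rewrite (proj2 (Hr j Hj)).
  apply injective_projections; cbn; ring.
Qed.

Lemma spoke_cross (i j : nat) :
  (i <= N)%nat -> (j <= N)%nat ->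
  cross (p i) (p j) = r i * r j * sin (alpha j - alpha i).
Proof.
  intros Hi Hj; rewrite !spoke_polar, cross_scal, cross_polar by assumption; reflexivity.
Qed.

Lemma spoke_cross_gt0 (k : nat) : 0 < cross (p k) (p (S k)).
Proof.
  assert (Hper : periodic_idx N (fun k => cross (p k) (p (S k)))).
  { intros j; unfold p; rewrite <- Nat.add_succ_l, !HY; reflexivity. }
  destruct (periodic_reduce_lt N _ k ltac:(lia) Hper) as [j [Hj E]]; rewrite E.
  rewrite spoke_cross by lia.
  pose proof (Halpha (S j) ltac:(lia)) as Ha; replace (S j - 1)%nat with j in Ha by lia.
  pose proof (proj1 (Hr j ltac:(lia))); pose proof (proj1 (Hr (S j) ltac:(lia))).
  apply Rmult_lt_0_compat; [nra | apply sin_gt_0; lra].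
Qed.

Lemma edge_spokes (k : nat) : edge Y k = minus (p (S k)) (p k).
Proof. unfold edge, p; apply injective_projections; cbn; ring. Qed.

Lemma spoke_edge_cross_gt0 (k : nat) :
  0 < cross (p k) (edge Y k) /\ 0 < cross (p (S k)) (edge Y k).
Proof.
  rewrite edge_spokes; pose proof (spoke_cross_gt0 k) as H.
  split; (replace (cross _ (minus _ _)) with (cross (p k) (p (S k)))
    by (unfold cross, minus, plus, opp; cbn; ring)); exact H.
Qed.

Section Hull.
Variable K : R * R -> Prop.
Hypothesis HK : convex_set K.
Hypothesis Hbd : forall z, polygon N Y z <-> boundary K z.

Lemma adherent_on_polygon (z : R * R) : polygon N Y z -> adherent K z.
Proof. intros Hz; apply Hbd in Hz; apply Hz. Qed.

Lemma edge_on_polygon (k : nat) (s : R) :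
  0 <= s <= 1 -> polygon N Y (plus (Y k) (scal s (edge Y k))).
Proof.
  intros Hs.
  assert (Hper : periodic_idx N (fun k => plus (Y k) (scal s (edge Y k)))).
  { intros j; rewrite HY, (edge_periodic N Y HY); reflexivity. }
  destruct (periodic_reduce_lt N _ k ltac:(lia) Hper) as [j [Hj E]]; rewrite E.
  exists (S j); split; [lia|]; replace (S j - 1)%nat with j by lia.
  exists s; split; [exact Hs | reflexivity].
Qed.

Lemma vertex_on_polygon (k : nat) : polygon N Y (Y k).
Proof.
  replace (Y k) with (plus (Y k) (scal 0 (edge Y k)))
    by (apply injective_projections; cbn; ring).
  apply edge_on_polygon; lra.
Qed.

(** The centre and the two ends of an edge span a triangle of positive area. *)
Lemma centre_off_polygon : ~ polygon N Y c.
Proof.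
  intros [j [Hj [s [_ E]]]].
  pose proof (spoke_cross_gt0 (j - 1)) as H; replace (S (j - 1)) with j in H by lia.
  pose proof (f_equal fst E) as E1; pose proof (f_equal snd E) as E2.
  unfold p, cross in H; cbn in *; nra.
Qed.

(** The ray from the centre opposite to the first vertex meets some edge, so
    the centre is between two points of the polygon, which are adherent. *)
Lemma centre_adherent : adherent K c.
Proof.
  assert (Hex : exists j, (j < N)%nat /\ alpha j < alpha 0%nat + PI <= alpha (S j)).
  { assert (G : forall n, (n <= N)%nat -> alpha 0%nat + PI <= alpha n ->
      exists j, (j < n)%nat /\ alpha j < alpha 0%nat + PI <= alpha (S j)).
    { induction n as [|n IH]; intros Hn H; [pose proof PI_RGT_0; lra|].
      destruct (Rle_lt_dec (alpha 0%nat + PI) (alpha n)) as [h|h].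
      - destruct (IH ltac:(lia) h) as [j [Hj E]]; exists j; split; [lia | exact E].
      - exists n; split; [lia | split; assumption]. }
    destruct (G N ltac:(lia)) as [j [Hj E]]; [pose proof PI_RGT_0; lra|].
    exists j; split; assumption. }
  destruct Hex as [j [Hj [H1 H2]]].
  pose proof (Halpha (S j) ltac:(lia)) as Ha; replace (S j - 1)%nat with j in Ha by lia.
  assert (W0 : 0 < cross (p j) (p (S j))) by apply spoke_cross_gt0.
  pose proof (proj1 (Hr 0 ltac:(lia))) as R0.
  pose proof (proj1 (Hr j ltac:(lia))) as R1; pose proof (proj1 (Hr (S j) ltac:(lia))) as R2.
  assert (W1 : 0 <= cross (p (S j)) (p 0%nat)).
  { rewrite spoke_cross by lia; apply Rmult_le_pos; [nra|].
    replace (alpha 0%nat - alpha (S j)) with (- (alpha (S j) - alpha 0%nat - PI) + - PI) by ring.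
    rewrite sin_plus, cos_neg, !sin_neg, sin_PI, cos_PI.
    pose proof (sin_ge_0 (alpha (S j) - alpha 0%nat - PI) ltac:(lra) ltac:(lra)); lra. }
  assert (W2 : 0 < cross (p 0%nat) (p j)).
  { rewrite spoke_cross by lia; apply Rmult_lt_0_compat; [nra|].
    apply sin_gt_0; [|lra].
    lra. }
  (* barycentric coordinates of the centre in the triangle of the three spokes *)
  set (w0 := cross (p j) (p (S j))) in *; set (w1 := cross (p (S j)) (p 0%nat)) in *.
  set (w2 := cross (p 0%nat) (p j)) in *.
  pose (m := plus (Y j) (scal (w2 / (w1 + w2)) (edge Y j))).
  assert (Hm : adherent K m).
  { apply adherent_on_polygon, edge_on_polygon; split; [apply Rdiv_le_0_compat; lra|].
    apply Rmult_le_reg_r with (w1 + w2); [lra|].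
    unfold Rdiv; rewrite Rmult_assoc, Rinv_l; lra. }
  apply (adherent_convex K (Y 0%nat) m c HK); [apply adherent_on_polygon, vertex_on_polygon | exact Hm|].
  exists ((w1 + w2) / (w0 + w1 + w2)); split.
  { split; [apply Rdiv_le_0_compat; lra|].
    apply Rmult_le_reg_r with (w0 + w1 + w2); [lra|].
    unfold Rdiv; rewrite Rmult_assoc, Rinv_l; lra. }
  assert (Hid : plus (scal w0 (p 0%nat)) (plus (scal w1 (p j)) (scal w2 (p (S j)))) = zero).
  { unfold w0, w1, w2, cross; apply injective_projections; cbn; ring. }
  assert (Hs : 0 < w0 + w1 + w2) by lra; assert (Hs' : 0 < w1 + w2) by lra.
  clearbody w0 w1 w2; unfold m, edge.
  pose proof (f_equal fst Hid) as I1; pose proof (f_equal snd Hid) as I2.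
  unfold p in I1, I2; cbn in I1, I2.
  apply injective_projections; cbn.
  - apply Rmult_eq_reg_l with (w0 + w1 + w2); [|lra].
    transitivity (w0 * fst (Y 0%nat) + w1 * fst (Y j) + w2 * fst (Y (S j))); [lra | field; lra].
  - apply Rmult_eq_reg_l with (w0 + w1 + w2); [|lra].
    transitivity (w0 * snd (Y 0%nat) + w1 * snd (Y j) + w2 * snd (Y (S j))); [lra | field; lra].
Qed.

(** A point of the closure that is off the boundary is interior. *)
Lemma centre_interior : locally c K.
Proof.
  apply NNPP; intros Hn; apply centre_off_polygon, Hbd; split; [exact Hn|].
  exact centre_adherent.
Qed.

(** A reflex vertex would be an inner point of the triangle spanned by the
    centre and its two neighbours, hence an inner point of the convex set. *)
Lemma edge_cross_ge0 (k : nat) : 0 <= cross (edge Y k) (edge Y (S k)).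
Proof.
  apply Rnot_lt_le; intros Hneg; rewrite !edge_spokes in Hneg.
  pose proof (spoke_cross_gt0 k) as H1; pose proof (spoke_cross_gt0 (S k)) as H2.
  set (a := cross (p k) (p (S k))) in *; set (b := cross (p (S k)) (p (S (S k)))) in *.
  set (d := cross (p k) (p (S (S k)))).
  assert (Hd : a + b < d).
  { replace (cross (minus (p (S k)) (p k)) (minus (p (S (S k))) (p (S k)))) with (a + b - d) in Hneg
      by (unfold a, b, d, cross, minus, plus, opp; cbn; ring); lra. }
  pose (m := plus (Y k) (scal (a / (a + b)) (minus (Y (S (S k))) (Y k)))).
  assert (Hm : adherent K m).
  { apply (adherent_convex K (Y k) (Y (S (S k))) m HK);
      [apply adherent_on_polygon, vertex_on_polygon ..|].
    exists (a / (a + b)); split; [|reflexivity].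
    split; [apply Rdiv_le_0_compat; lra|].
    apply Rmult_le_reg_r with (a + b); [lra|]; unfold Rdiv; rewrite Rmult_assoc, Rinv_l; lra. }
  assert (Hs : 0 <= (a + b) / d < 1).
  { split; [apply Rdiv_le_0_compat; lra|].
    apply Rmult_lt_reg_r with d; [lra|]; unfold Rdiv; rewrite Rmult_assoc, Rinv_l; lra. }
  pose proof (interior_segment K c m _ HK centre_interior Hm Hs) as Hin.
  apply (proj1 (proj1 (Hbd (Y (S k))) (vertex_on_polygon (S k)))).
  replace (Y (S k)) with (plus c (scal ((a + b) / d) (minus m c))); [exact Hin|].
  assert (Hid : scal d (p (S k)) = plus (scal b (p k)) (scal a (p (S (S k))))).
  { unfold a, b, d, cross; apply injective_projections; cbn; ring. }
  clearbody a b d; unfold m.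
  pose proof (f_equal fst Hid) as I1; pose proof (f_equal snd Hid) as I2.
  unfold p in I1, I2; cbn in I1, I2.
  apply injective_projections; cbn.
  - apply Rmult_eq_reg_l with d; [|lra].
    transitivity (d * fst c + b * (fst (Y k) - fst c) + a * (fst (Y (S (S k))) - fst c));
      [field; lra | lra].
  - apply Rmult_eq_reg_l with d; [|lra].
    transitivity (d * snd c + b * (snd (Y k) - snd c) + a * (snd (Y (S (S k))) - snd c));
      [field; lra | lra].
Qed.

End Hull.

Lemma edge_len_gt0_of_spokes (k : nat) : 0 < edge_len Y k.
Proof.
  apply (cross_gt0_norm (p k)), spoke_edge_cross_gt0.
Qed.

(** Between consecutive spokes, the direction of the edge relative to the
    spoke decreases by the angle of the spokes, and it increases by the turning
    angle at each vertex. *)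
Lemma sum_turn_angles :
  (forall k, 0 < cross (edge Y k) (edge Y (S k))) ->
  sum1 (turn_angle Y) N = 2 * PI.
Proof.
  intros Hedge.
  pose (u := fun k => unit_vec (p k)); pose (beta := fun k => angle (u k) (tangent Y k)).
  assert (Hu : forall k, dot (u k) (u k) = 1).
  { intros k; apply unit_vec_unit, (cross_gt0_norm _ _ (spoke_cross_gt0 k)). }
  assert (HT : forall k, dot (tangent Y k) (tangent Y k) = 1).
  { intros k; apply tangent_unit, edge_len_gt0_of_spokes. }
  assert (C1 : forall k, 0 < cross (u k) (tangent Y k)).
  { intros k; apply cross_unit_vec_gt0, spoke_edge_cross_gt0. }
  assert (C2 : forall k, 0 < cross (u (S k)) (tangent Y k)).
  { intros k; apply cross_unit_vec_gt0, spoke_edge_cross_gt0. }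
  assert (E : forall k, turn_angle Y k = angle (u k) (u (S k)) + (beta (S k) - beta k)).
  { intros k; unfold beta.
    rewrite (angle_add (u k) (u (S k)) (tangent Y k) (Hu _) (Hu _) (HT _)
               (cross_unit_vec_gt0 _ _ (spoke_cross_gt0 k)) (C2 k) (C1 k)).
    rewrite (angle_add (u (S k)) (tangent Y k) (tangent Y (S k)) (Hu _) (HT _) (HT _)
               (C2 k) (cross_unit_vec_gt0 _ _ (Hedge k)) (C1 (S k))).
    unfold turn_angle; ring. }
  assert (Hup : periodic_idx N u) by (intros k; unfold u, p; rewrite HY; reflexivity).
  rewrite (sum1_ext _ _ N (fun k _ => E k)), sum1_plus, sum1_minus, sum1_succ, Rminus_diag, Rplus_0_r.
  2:{ intros k; unfold beta; rewrite Hup, (tangent_periodic N Y HY); reflexivity. }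
  rewrite <- (sum1_pred N (fun k => angle (u k) (u (S k))))
    by (intros k; rewrite <- Nat.add_succ_l, !Hup; reflexivity).
  rewrite (sum1_ext _ (fun k => alpha k - alpha (k - 1)%nat)).
  - assert (G : forall n, sum1 (fun k => alpha k - alpha (k - 1)%nat) n = alpha n - alpha 0%nat).
    { induction n as [|n IH]; [rewrite sum1_0; ring|].
      rewrite sum1_S, IH; replace (S n - 1)%nat with n by lia; ring. }
    rewrite G, Hturn; ring.
  - intros k Hk; replace (S (k - 1)) with k by lia.
    assert (Hpol : forall j, (j <= N)%nat -> u j = (cos (alpha j), sin (alpha j))).
    { intros j Hj; unfold u; rewrite spoke_polar by exact Hj.
      assert (Hn : norm (cos (alpha j), sin (alpha j)) = 1).
      { rewrite norm_pair; unfold dot; cbn.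
        pose proof (sin2_cos2 (alpha j)) as H; unfold Rsqr in H.
        replace (_ + _) with 1 by lra; apply sqrt_1. }
      rewrite unit_vec_scal_pos; [|apply Hr, Hj | rewrite Hn; lra].
      unfold unit_vec; rewrite Hn; apply injective_projections; cbn; field. }
    rewrite !Hpol by lia; unfold angle, dot; cbn [fst snd].
    rewrite <- (acos_cos (alpha k - alpha (k - 1)%nat)) by (pose proof (Halpha k Hk); lra).
    f_equal; rewrite cos_minus; ring.
Qed.

End Centre.

Lemma collinear_of_cross_eq0 (a b d : R * R) :
  0 < norm (minus b a) -> cross (minus b a) (minus d b) = 0 -> collinear a b d.
Proof.
  intros Hn Hc; pose proof (norm_pair_sq (minus b a)) as Hd.
  set (e := minus b a) in *; set (g := minus d b) in *.
  assert (Hdd : d = plus b g) by (unfold g; apply injective_projections; cbn; ring).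
  assert (Hb : b = plus a e) by (unfold e; apply injective_projections; cbn; ring).
  clearbody e g; assert (Hde : 0 < dot e e) by nra.
  assert (Hg : g = scal (dot e g / dot e e) e).
  { destruct e as [e1 e2], g as [g1 g2]; unfold dot, cross in *; cbn in *.
    apply injective_projections; cbn; apply Rmult_eq_reg_r with (e1 * e1 + e2 * e2);
      try (apply Rgt_not_eq; exact Hde).
    - transitivity ((e1 * g1 + e2 * g2) * e1 - e2 * (e1 * g2 - e2 * g1));
        [ring | rewrite Hc; field; lra].
    - transitivity ((e1 * g1 + e2 * g2) * e2 + e1 * (e1 * g2 - e2 * g1));
        [ring | rewrite Hc; field; lra]. }
  revert Hg; generalize (dot e g / dot e e); intros l ->.
  exists a, e, 0, 1, (1 + l); subst b d; repeat split;
    apply injective_projections; cbn; ring.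
Qed.

(** Left turns are weak by convexity ([edge_cross_ge0]) and strict because
    adjacent edges are not collinear. *)
Lemma convex_polygon_turns :
  convex_N_polygon N Y ->
  (forall k, 0 < turn_sin Y k) /\ sum1 (turn_angle Y) N = 2 * PI.
Proof.
  intros [Hcol [[c [r [alpha [Hr [Ha Ht]]]]] [K [HK Hbd]]]].
  pose proof (edge_len_gt0_of_spokes c r alpha Hr Ha) as Hq.
  assert (Hedge : forall k, 0 < cross (edge Y k) (edge Y (S k))).
  { assert (Hper : periodic_idx N (fun k => cross (edge Y k) (edge Y (S k)))).
    { intros j; rewrite <- Nat.add_succ_l, !(edge_periodic N Y HY); reflexivity. }
    intros k; destruct (periodic_reduce_lt N _ k ltac:(lia) Hper) as [j [Hj E]]; rewrite E.
    destruct (edge_cross_ge0 c r alpha Hr Ha Ht K HK Hbd j) as [H|H]; [exact H|exfalso].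
    apply (Hcol (S j) ltac:(lia)).
    replace (S j - 1)%nat with j by lia; replace (S j + 1)%nat with (S (S j)) by lia.
    apply collinear_of_cross_eq0; [apply (Hq j) | symmetry; exact H]. }
  split.
  - intros k; apply cross_unit_vec_gt0, Hedge.
  - apply (sum_turn_angles c r alpha Hr Ha Ht Hedge).
Qed.

End ConvexPolygon.

(** * Finite elements *)

Lemma is_RInt_quadratic (a b al be ga : R) (f : R -> R) :
  a < b ->
  (forall x, a < x < b ->
     f x = al + be * ((x - a) / (b - a)) + ga * ((x - a) / (b - a)) ^ 2) ->
  is_RInt f a b ((b - a) * (al + be / 2 + ga / 3)).
Proof.
  intros Hab Hf.
  apply is_RInt_ext with
    (fun x => al + be * ((x - a) / (b - a)) + ga * ((x - a) / (b - a)) ^ 2).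
  { intros x Hx; rewrite Rmin_left, Rmax_right in Hx by lra; symmetry; apply Hf, Hx. }
  set (F := fun x => (b - a) * (al * ((x - a) / (b - a)) + be / 2 * ((x - a) / (b - a)) ^ 2
                                + ga / 3 * ((x - a) / (b - a)) ^ 3)).
  replace ((b - a) * (al + be / 2 + ga / 3)) with (minus (F b) (F a))
    by (unfold F, minus, plus, opp; cbn; field; lra).
  apply (is_RInt_derive F).
  - intros x _; unfold F; auto_derive; [trivial | field; lra].
  - intros x _; apply (ex_derive_continuous (V := R_NormedModule)).
    auto_derive; trivial.
Qed.

Lemma fst_fe_comb (N : nat) (phi : nat -> R -> R) (c : nat -> R * R) (x : R) :
  fst (fe_comb N phi c x) = sum1 (fun j => phi j x * fst (c j)) N.
Proof.
  unfold fe_comb, sum1; induction N as [|n IH].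
  - rewrite !sum_n_m_zero by lia; reflexivity.
  - rewrite !sum_n_Sm by lia; exact (f_equal2 Rplus IH eq_refl).
Qed.

Lemma snd_fe_comb (N : nat) (phi : nat -> R -> R) (c : nat -> R * R) (x : R) :
  snd (fe_comb N phi c x) = sum1 (fun j => phi j x * snd (c j)) N.
Proof.
  unfold fe_comb, sum1; induction N as [|n IH].
  - rewrite !sum_n_m_zero by lia; reflexivity.
  - rewrite !sum_n_Sm by lia; exact (f_equal2 Rplus IH eq_refl).
Qed.

Section FiniteElements.
Variables (N : nat) (xi : nat -> R) (phi : nat -> R -> R).
Hypothesis HN : (3 <= N)%nat.
Hypothesis Hxi : is_partition N xi.
Hypothesis Hphi : is_nodal_basis N xi phi.

Lemma nodes_increasing (i j : nat) : (i <= j)%nat -> (j <= N)%nat -> xi i <= xi j.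
Proof.
  intros H; induction H as [|j _ IH]; intros Hj; [lra|].
  destruct Hxi as [_ [_ Hs]]; specialize (Hs (S j) ltac:(lia)).
  replace (S j - 1)%nat with j in Hs by lia.
  specialize (IH ltac:(lia)); lra.
Qed.

Lemma is_RInt_elements (f : R -> R) (J : nat -> R) :
  (forall i, (1 <= i <= N)%nat -> is_RInt f (xi (i - 1)%nat) (xi i) (J i)) ->
  is_RInt f 0 (2 * PI) (sum1 J N).
Proof.
  intros H; destruct Hxi as [H0 [HNpi _]]; rewrite <- H0 at 1; rewrite <- HNpi.
  assert (G : forall n, (n <= N)%nat -> is_RInt f (xi 0%nat) (xi n) (sum1 J n)).
  { induction n as [|n IH]; intros Hn.
    - rewrite sum1_0; apply (is_RInt_point f).
    - rewrite sum1_S; apply (is_RInt_Chasles f _ (xi n)); [apply IH; lia|].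
      specialize (H (S n) ltac:(lia)).
      replace (S n - 1)%nat with n in H by lia; exact H. }
  apply G; lia.
Qed.

Lemma mesh_fun_element (i : nat) (x : R) :
  (1 <= i <= N)%nat -> xi (i - 1)%nat < x < xi i ->
  mesh_fun N xi x = xi i - xi (i - 1)%nat.
Proof.
  intros Hi Hx; unfold mesh_fun.
  match goal with |- sum_n_m ?f 1 N = _ =>
    change (sum1 f N = xi i - xi (i - 1)%nat); rewrite (sum1_single f N i Hi) end.
  - destruct Rlt_dec; [destruct Rle_dec|]; lra.
  - intros k Hk Hki; destruct Rlt_dec as [h1|]; [destruct Rle_dec as [h2|]|]; try lra.
    destruct (Nat.lt_ge_cases k i) as [h|h].
    + pose proof (nodes_increasing k (i - 1) ltac:(lia) ltac:(lia)); lra.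
    + pose proof (nodes_increasing i (k - 1) ltac:(lia) ltac:(lia)); lra.
Qed.

Definition pw_affine (g : R -> R) : Prop :=
  forall j, (1 <= j <= N)%nat -> exists a b,
    forall x, xi (j - 1)%nat <= x <= xi j -> g x = a + x * b.

Lemma pw_affine_eq (g : R -> R) (i : nat) (x : R) :
  pw_affine g -> (1 <= i <= N)%nat -> xi (i - 1)%nat <= x <= xi i ->
  g x = g (xi (i - 1)%nat)
        + (x - xi (i - 1)%nat) / (xi i - xi (i - 1)%nat) * (g (xi i) - g (xi (i - 1)%nat)).
Proof.
  intros Hg Hi Hx; destruct (Hg i Hi) as [a [b E]].
  destruct Hxi as [_ [_ Hs]]; specialize (Hs i Hi).
  rewrite !E by lra; field; lra.
Qed.

Lemma nodal_at_node (i j : nat) :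
  (1 <= i <= N)%nat -> (1 <= j <= N)%nat -> phi j (xi i) = if Nat.eqb i j then 1 else 0.
Proof. intros Hi Hj; apply (Hphi j Hj), Hi. Qed.

Lemma fe_comb_periodic (c : nat -> R * R) : periodic_fun (fe_comb N phi c).
Proof.
  intros x; apply sum_n_m_ext_loc; intros j Hj.
  destruct (Hphi j Hj) as [[_ [Hp _]] _]; rewrite Hp; reflexivity.
Qed.

Lemma fe_comb_node_pos (c : nat -> R * R) (i : nat) :
  (1 <= i <= N)%nat -> fe_comb N phi c (xi i) = c i.
Proof.
  intros Hi; apply injective_projections; rewrite ?fst_fe_comb, ?snd_fe_comb;
    (rewrite (sum1_single _ N i Hi);
     [rewrite nodal_at_node, Nat.eqb_refl by exact Hi; ring|]);
    intros k Hk Hki; rewrite nodal_at_node by assumption;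
    replace (Nat.eqb i k) with false by (symmetry; apply Nat.eqb_neq; lia); ring.
Qed.

(** The node 0 carries the value at the node [N], by periodicity of both the
    basis and the coefficients. *)
Lemma fe_comb_node (c : nat -> R * R) (i : nat) :
  periodic_idx N c -> (i <= N)%nat -> fe_comb N phi c (xi i) = c i.
Proof.
  intros Hc Hi; destruct i as [|i]; [|apply fe_comb_node_pos; lia].
  rewrite <- (Hc 0%nat), <- (fe_comb_node_pos c (0 + N)) by lia.
  destruct Hxi as [H0 [H1 _]]; cbn [Nat.add]; rewrite H0, H1.
  rewrite <- (fe_comb_periodic c 0), Rplus_0_l; reflexivity.
Qed.

Lemma sum_phi_affine (a : nat -> R) (n : nat) : (n <= N)%nat ->
  pw_affine (fun x => sum1 (fun j => phi j x * a j) n).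
Proof.
  intros Hn i Hi; induction n as [|n IH].
  - exists 0, 0; intros x _; rewrite sum1_0; ring.
  - destruct (IH ltac:(lia)) as [p [r E]].
    destruct (Hphi (S n) ltac:(lia)) as [[_ [_ Ha]] _].
    destruct (Ha i Hi) as [p' [r' E']].
    exists (p + p' * a (S n)), (r + r' * a (S n)); intros x Hx.
    rewrite sum1_S, E, E' by exact Hx; cbn; ring.
Qed.

Lemma fe_comb_fst_affine (c : nat -> R * R) : pw_affine (fun x => fst (fe_comb N phi c x)).
Proof.
  intros i Hi; destruct (sum_phi_affine (fun j => fst (c j)) N (Nat.le_refl N) i Hi) as [a [b E]].
  exists a, b; intros x Hx; rewrite fst_fe_comb; apply E, Hx.
Qed.

Lemma fe_comb_snd_affine (c : nat -> R * R) : pw_affine (fun x => snd (fe_comb N phi c x)).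
Proof.
  intros i Hi; destruct (sum_phi_affine (fun j => snd (c j)) N (Nat.le_refl N) i Hi) as [a [b E]].
  exists a, b; intros x Hx; rewrite snd_fe_comb; apply E, Hx.
Qed.

Lemma fe_comb_in_space (c : nat -> R * R) : fe_space N xi (fe_comb N phi c).
Proof.
  split; [|split; [apply fe_comb_periodic|]].
  - intros x; unfold fe_comb.
    set (V := prod_NormedModule R_AbsRing R_NormedModule R_NormedModule).
    enough (H : forall n, (n <= N)%nat ->
              continuous (fun y : R => sum_n_m (fun j => scal (phi j y) (c j)) 1 n : V) x)
      by (apply H; lia).
    induction n as [|n IH]; intros Hn.
    + apply continuous_ext with (fun _ : R => zero : V);
        [intros y; rewrite sum_n_m_zero by lia; reflexivity | apply continuous_const].
    + apply continuous_ext with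
        (fun y : R => plus (sum_n_m (fun j => scal (phi j y) (c j)) 1 n)
                           (scal (phi (S n) y) (c (S n))) : V);
        [intros y; rewrite sum_n_Sm by lia; reflexivity|].
      apply (continuous_plus (V := V)); [apply IH; lia|].
      apply (continuous_scal_l (V := V)), (Hphi (S n) ltac:(lia)).
  - intros i Hi; destruct (fe_comb_fst_affine c i Hi) as [a [b E]].
    destruct (fe_comb_snd_affine c i Hi) as [a' [b' E']].
    exists (a, a'), (b, b'); intros x Hx.
    apply injective_projections; [apply E, Hx | apply E', Hx].
Qed.

Lemma fe_comb_element (c : nat -> R * R) (i : nat) (x : R) :
  periodic_idx N c -> (1 <= i <= N)%nat -> xi (i - 1)%nat <= x <= xi i ->
  fe_comb N phi c x
  = plus (c (i - 1)%nat)
      (scal ((x - xi (i - 1)%nat) / (xi i - xi (i - 1)%nat)) (edge c (i - 1))).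
Proof.
  intros Hc Hi Hx; unfold edge; replace (S (i - 1)) with i by lia.
  apply injective_projections.
  - rewrite (pw_affine_eq _ i x (fe_comb_fst_affine c) Hi Hx).
    rewrite !fe_comb_node by (assumption || lia); reflexivity.
  - rewrite (pw_affine_eq _ i x (fe_comb_snd_affine c) Hi Hx).
    rewrite !fe_comb_node by (assumption || lia); reflexivity.
Qed.

Lemma dxi_fe_comb (c : nat -> R * R) (i : nat) (x : R) :
  periodic_idx N c -> (1 <= i <= N)%nat -> xi (i - 1)%nat < x < xi i ->
  dxi (fe_comb N phi c) x = scal (/ (xi i - xi (i - 1)%nat)) (edge c (i - 1)).
Proof.
  intros Hc Hi Hx.
  assert (Hloc : locally x (fun y => xi (i - 1)%nat <= y <= xi i)).
  { assert (Hd : 0 < Rmin (x - xi (i - 1)%nat) (xi i - x)) by (apply Rmin_glb_lt; lra).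
    exists (mkposreal _ Hd); intros y Hy; change (Rabs (y - x) < Rmin (x - xi (i - 1)%nat) (xi i - x)) in Hy.
    pose proof (Rmin_l (x - xi (i - 1)%nat) (xi i - x)).
    pose proof (Rmin_r (x - xi (i - 1)%nat) (xi i - x)).
    apply Rabs_def2 in Hy; lra. }
  unfold dxi; apply injective_projections; cbn [fst snd].
  - rewrite (Derive_ext_loc _ (fun y => fst (c (i - 1)%nat)
      + (y - xi (i - 1)%nat) / (xi i - xi (i - 1)%nat) * fst (edge c (i - 1)))).
    + apply is_derive_unique; auto_derive; [trivial | cbn; field; lra].
    + revert Hloc; apply filter_imp; intros y Hy.
      rewrite (fe_comb_element c i y Hc Hi Hy); reflexivity.
  - rewrite (Derive_ext_loc _ (fun y => snd (c (i - 1)%nat)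
      + (y - xi (i - 1)%nat) / (xi i - xi (i - 1)%nat) * snd (edge c (i - 1)))).
    + apply is_derive_unique; auto_derive; [trivial | cbn; field; lra].
    + revert Hloc; apply filter_imp; intros y Hy.
      rewrite (fe_comb_element c i y Hc Hi Hy); reflexivity.
Qed.

(** * From the weak form to the vertex equations *)

(** Convertible to the left-hand side in [semidiscrete_solution] at a fixed
    time; the curve [Z], its velocity [W] and its perimeter [L] are separate
    arguments. *)
Definition weak_form (L : R) (Z W v : R -> R * R) : R :=
  RInt (fun x => norm (dxi Z x) * dot (W x) (v x)) 0 (2 * PI)
  + RInt (fun x => dot (unit_vec (dxi Z x)) (dxi v x)) 0 (2 * PI)
  + RInt (fun x => mesh_fun N xi x ^ 2 * norm (dxi Z x) / 6
                     * dot (dxi W x) (dxi v x)) 0 (2 * PI)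
  + RInt (fun x => 2 * PI / L * dot (perp (dxi Z x)) (v x)) 0 (2 * PI).

Variables (Y D : nat -> R * R).
Hypothesis HY : periodic_idx N Y.
Hypothesis HD : periodic_idx N D.
Hypothesis Hq : forall k, 0 < edge_len Y k.

Let L := perimeter N Y.

(** The term with the squared mesh size turns the exact mass matrix into the
    lumped one, so that every edge only couples the velocity of a vertex with
    the test value at the same vertex. *)
Lemma weak_form_nodal (C : nat -> R * R) :
  periodic_idx N C ->
  weak_form L (fe_comb N phi Y) (fe_comb N phi D) (fe_comb N phi C)
  = sum1 (fun k =>
      edge_len Y k / 2 * (dot (D k) (C k) + dot (D (S k)) (C (S k)))
      + dot (tangent Y k) (edge C k)
      + PI / L * dot (perp (edge Y k)) (plus (C k) (C (S k)))) N.
Proof.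
  intros HC; pose proof (perimeter_gt0 N Y HN HY Hq : 0 < L) as HL.
  pose (h := fun i : nat => xi i - xi (i - 1)%nat).
  assert (Hh : forall i, (1 <= i <= N)%nat -> 0 < h i).
  { intros i Hi; destruct Hxi as [_ [_ Hs]]; specialize (Hs i Hi); unfold h; lra. }
  assert (HDX : forall i x, (1 <= i <= N)%nat -> xi (i - 1)%nat < x < xi i ->
    norm (dxi (fe_comb N phi Y) x) = / h i * edge_len Y (i - 1)).
  { intros i x Hi Hx; rewrite (dxi_fe_comb Y i x HY Hi Hx).
    apply norm_scal_pos, Rinv_0_lt_compat, Hh, Hi. }
  assert (HTX : forall i x, (1 <= i <= N)%nat -> xi (i - 1)%nat < x < xi i ->
    unit_vec (dxi (fe_comb N phi Y) x) = tangent Y (i - 1)).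
  { intros i x Hi Hx; rewrite (dxi_fe_comb Y i x HY Hi Hx).
    apply unit_vec_scal_pos; [apply Rinv_0_lt_compat, Hh, Hi | apply Hq]. }
  assert (E1 : RInt (fun x => norm (dxi (fe_comb N phi Y) x)
                 * dot (fe_comb N phi D x) (fe_comb N phi C x)) 0 (2 * PI)
    = sum1 (fun i => edge_len Y (i - 1) * (dot (D (i - 1)%nat) (C (i - 1)%nat)
        + (dot (D (i - 1)%nat) (edge C (i - 1)) + dot (edge D (i - 1)) (C (i - 1)%nat)) / 2
        + dot (edge D (i - 1)) (edge C (i - 1)) / 3)) N).
  { apply is_RInt_unique, is_RInt_elements; intros i Hi; pose proof (Hh i Hi) as Hi0.
    evar_last.
    - apply is_RInt_quadratic with
        (al := / h i * edge_len Y (i - 1) * dot (D (i - 1)%nat) (C (i - 1)%nat))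
        (be := / h i * edge_len Y (i - 1)
           * (dot (D (i - 1)%nat) (edge C (i - 1)) + dot (edge D (i - 1)) (C (i - 1)%nat)))
        (ga := / h i * edge_len Y (i - 1) * dot (edge D (i - 1)) (edge C (i - 1)));
        [unfold h in Hi0; lra|].
      intros x Hx; rewrite (HDX i x Hi Hx).
      rewrite (fe_comb_element D i x HD Hi ltac:(lra)), (fe_comb_element C i x HC Hi ltac:(lra)).
      fold (h i); set (sg := (x - xi (i - 1)%nat) / h i).
      unfold dot; cbn; ring.
    - fold (h i); field; lra. }
  assert (E2 : RInt (fun x => dot (unit_vec (dxi (fe_comb N phi Y) x))
                                  (dxi (fe_comb N phi C) x)) 0 (2 * PI)
    = sum1 (fun i => dot (tangent Y (i - 1)) (edge C (i - 1))) N).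
  { apply is_RInt_unique, is_RInt_elements; intros i Hi; pose proof (Hh i Hi) as Hi0.
    evar_last.
    - apply is_RInt_quadratic with
        (al := / h i * dot (tangent Y (i - 1)) (edge C (i - 1))) (be := 0) (ga := 0);
        [unfold h in Hi0; lra|].
      intros x Hx; rewrite (HTX i x Hi Hx), (dxi_fe_comb C i x HC Hi Hx).
      fold (h i); unfold dot; cbn; ring.
    - fold (h i); field; lra. }
  assert (E3 : RInt (fun x => mesh_fun N xi x ^ 2 * norm (dxi (fe_comb N phi Y) x) / 6
                 * dot (dxi (fe_comb N phi D) x) (dxi (fe_comb N phi C) x)) 0 (2 * PI)
    = sum1 (fun i => edge_len Y (i - 1) / 6 * dot (edge D (i - 1)) (edge C (i - 1))) N).
  { apply is_RInt_unique, is_RInt_elements; intros i Hi; pose proof (Hh i Hi) as Hi0.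
    evar_last.
    - apply is_RInt_quadratic with
        (al := / h i * (edge_len Y (i - 1) / 6) * dot (edge D (i - 1)) (edge C (i - 1)))
        (be := 0) (ga := 0); [unfold h in Hi0; lra|].
      intros x Hx; rewrite (HDX i x Hi Hx), (mesh_fun_element i x Hi Hx).
      rewrite (dxi_fe_comb C i x HC Hi Hx), (dxi_fe_comb D i x HD Hi Hx).
      fold (h i); unfold dot; cbn; field; lra.
    - fold (h i); field; lra. }
  assert (E4 : RInt (fun x => 2 * PI / L * dot (perp (dxi (fe_comb N phi Y) x))
                                               (fe_comb N phi C x)) 0 (2 * PI)
    = sum1 (fun i => 2 * PI / L * (dot (perp (edge Y (i - 1))) (C (i - 1)%nat)
                + dot (perp (edge Y (i - 1))) (edge C (i - 1)) / 2)) N).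
  { apply is_RInt_unique, is_RInt_elements; intros i Hi; pose proof (Hh i Hi) as Hi0.
    evar_last.
    - apply is_RInt_quadratic with
        (al := / h i * (2 * PI / L * dot (perp (edge Y (i - 1))) (C (i - 1)%nat)))
        (be := / h i * (2 * PI / L * dot (perp (edge Y (i - 1))) (edge C (i - 1))))
        (ga := 0); [unfold h in Hi0; lra|].
      intros x Hx; rewrite (dxi_fe_comb Y i x HY Hi Hx).
      rewrite (fe_comb_element C i x HC Hi ltac:(lra)).
      fold (h i); set (sg := (x - xi (i - 1)%nat) / h i).
      unfold dot, perp; cbn; ring.
    - fold (h i); field; lra. }
  unfold weak_form; rewrite E1, E2, E3, E4, <- !sum1_plus.
  match goal with |- _ = sum1 ?f N => rewrite <- (sum1_pred N f) end.
  - apply sum1_ext; intros i Hi; clear - HL; revert HL.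
    generalize L, (edge_len Y (i - 1)), (tangent Y (i - 1)); intros l q u Hl.
    unfold edge, dot, perp; cbn; unfold Rdiv; field; lra.
  - intros k; rewrite (edge_len_periodic N Y HY), (tangent_periodic N Y HY).
    rewrite (edge_periodic N C HC), (edge_periodic N Y HY).
    rewrite <- Nat.add_succ_l, !HD, !HC; reflexivity.
Qed.

(** The test function has the residuals of the vertex equations as nodal
    values, so that the weak form becomes the sum of their squared norms. *)
Lemma vertex_ode_of_weak_form :
  (forall v, fe_space N xi v ->
     weak_form L (fe_comb N phi Y) (fe_comb N phi D) v = 0) ->
  vertex_ode N Y D.
Proof.
  intros Hweak; pose proof (perimeter_gt0 N Y HN HY Hq : 0 < L) as HL.
  pose (Res := fun k => minus (scal ((edge_len Y k + edge_len Y (S k)) / 2) (D (S k)))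
    (minus (minus (tangent Y (S k)) (tangent Y k))
        (scal (PI / L) (perp (minus (Y (S (S k))) (Y k)))))).
  assert (HRes : periodic_idx N Res).
  { intros k; unfold Res.
    rewrite <- !Nat.add_succ_l, !HY, HD, !(edge_len_periodic N Y HY), !(tangent_periodic N Y HY).
    reflexivity. }
  (* the residual [Res k] belongs to the vertex [S k]; the shift by [N - 1]
     stands for the predecessor modulo [N] *)
  pose (C := fun k => Res (k + (N - 1))%nat).
  assert (HC : periodic_idx N C).
  { intros k; unfold C; rewrite <- (HRes (k + (N - 1))%nat); f_equal; lia. }
  assert (HCS : forall k, C (S k) = Res k).
  { intros k; unfold C; rewrite <- (HRes k); f_equal; lia. }
  pose proof (Hweak _ (fe_comb_in_space C)) as E.
  rewrite (weak_form_nodal C HC) in E.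
  pose (A := fun k => edge_len Y k / 2 * dot (D (S k)) (C (S k)) + dot (tangent Y k) (C (S k))
     + PI / L * dot (perp (edge Y k)) (C (S k))).
  pose (B := fun k => edge_len Y k / 2 * dot (D k) (C k) - dot (tangent Y k) (C k)
     + PI / L * dot (perp (edge Y k)) (C k)).
  rewrite (sum1_ext _ (fun k => A k + B k)) in E
    by (intros; unfold A, B, edge, dot; cbn; ring).
  rewrite sum1_plus, <- (sum1_succ N B), <- sum1_plus in E.
  - rewrite (sum1_ext _ (fun k => dot (Res k) (Res k))) in E.
    + assert (H0 : forall k, (1 <= k <= N)%nat -> dot (Res k) (Res k) = 0).
      { apply sum1_nonneg_eq0; [intros; apply dot_self_ge0 | exact E]. }
      intros k; destruct (periodic_reduce N Res k ltac:(lia) HRes) as [j [Hj Ej]].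
      specialize (H0 j Hj); rewrite <- Ej in H0.
      destruct (Rplus_sqr_eq_0 _ _ H0) as [F1 F2].
      apply injective_projections; apply Rminus_diag_uniq; [exact F1 | exact F2].
    + intros k _; unfold A, B; rewrite HCS.
      generalize (Res k) at 1 2 3 4 5 6 7 as r; intros r; unfold Res; revert HL.
      generalize L, (edge_len Y k), (edge_len Y (S k)), (tangent Y k), (tangent Y (S k)).
      intros l q q' u u' Hl; unfold edge, dot, perp; cbn; field; lra.
  - intros k; unfold B.
    rewrite HC, HD, (edge_len_periodic N Y HY), (tangent_periodic N Y HY), (edge_periodic N Y HY).
    reflexivity.
Qed.

End FiniteElements.

(** * Derivatives within a time interval *)

Lemma within_proper (T t : R) :
  0 <= t <= T -> ProperFilter (within (fun s => 0 <= s <= T) (locally t)).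
Proof.
  intros Ht; constructor; [|apply within_filter, locally_filter].
  intros P [d Hd]; exists t; apply Hd; [apply ball_center | exact Ht].
Qed.

Lemma is_derive_on_epsilon {V : NormedModule R_AbsRing} (T : R) (f : R -> V) (t : R) (l : V) :
  0 <= t <= T ->
  is_derive_on T f t l <->
  (forall eps : posreal, exists d : posreal, forall s, 0 <= s <= T ->
     Rabs (s - t) < d ->
     norm (minus (minus (f s) (f t)) (scal (s - t) l)) <= eps * Rabs (s - t)).
Proof.
  intros Ht; pose proof (within_proper T t Ht) as HF; split.
  - intros [_ H] eps.
    destruct (H t) with (eps := eps) as [d Hd].
    + intros P HP; apply filter_le_within, HP.
    + exists d; intros s Hs Hst; apply Hd; assumption.
  - intros H; split; [exact (is_linear_scal_l (K := R_AbsRing) l)|].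
    intros x Hx eps.
    assert (E : x = t).
    { apply (is_filter_lim_unique (F := within (fun s => 0 <= s <= T) (locally t))); [exact Hx|].
      intros P HP; apply filter_le_within, HP. }
    subst x; destruct (H eps) as [d Hd]; exists d; intros s Hst Hs.
    apply Hd; assumption.
Qed.

Lemma is_derive_on_fst (T : R) (f : R -> R * R) (t : R) (l : R * R) :
  is_derive_on T f t l -> is_derive_on T (fun s => fst (f s)) t (fst l).
Proof.
  intros H; apply filterdiff_ext_lin with (fun s => fst (scal s l)).
  - apply (filterdiff_comp f (fun p => fst p) _ (fun p => fst p) H).
    apply filterdiff_linear, is_linear_fst.
  - intros s; destruct l; reflexivity.
Qed.

Lemma is_derive_on_snd (T : R) (f : R -> R * R) (t : R) (l : R * R) :
  is_derive_on T f t l -> is_derive_on T (fun s => snd (f s)) t (snd l).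
Proof.
  intros H; apply filterdiff_ext_lin with (fun s => snd (scal s l)).
  - apply (filterdiff_comp f (fun p => snd p) _ (fun p => snd p) H).
    apply filterdiff_linear, is_linear_snd.
  - intros s; destruct l; reflexivity.
Qed.

(** Every point of a nondegenerate interval is a limit of other points of the
    interval. *)
Lemma is_derive_on_unique (T : R) (f : R -> R) (t l1 l2 : R) :
  0 < T -> 0 <= t <= T ->
  is_derive_on T f t l1 -> is_derive_on T f t l2 -> l1 = l2.
Proof.
  intros HT Ht H1 H2.
  pose proof (proj1 (is_derive_on_epsilon (V := R_NormedModule) T f t l1 Ht) H1) as K1.
  pose proof (proj1 (is_derive_on_epsilon (V := R_NormedModule) T f t l2 Ht) H2) as K2.
  destruct (Req_dec l1 l2) as [E|E]; [exact E|exfalso].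
  assert (He : 0 < Rabs (l1 - l2) / 3).
  { apply Rdiv_lt_0_compat; [apply Rabs_pos_lt; lra | lra]. }
  destruct (K1 (mkposreal _ He)) as [d1 Hd1], (K2 (mkposreal _ He)) as [d2 Hd2].
  set (d := Rmin (Rmin d1 d2 / 2) (T / 2)).
  assert (Hd : 0 < d /\ d < d1 /\ d < d2 /\ d <= T / 2).
  { destruct d1 as [d1 P1], d2 as [d2 P2]; unfold d; cbn.
    repeat split; repeat (unfold Rmin; destruct Rle_dec); lra. }
  assert (exists s, 0 <= s <= T /\ Rabs (s - t) = d) as [s [Hs Es]].
  { destruct (Rle_dec t (T / 2)).
    - exists (t + d); rewrite Rabs_right; lra.
    - exists (t - d); rewrite Rabs_left; lra. }
  specialize (Hd1 s Hs ltac:(lra)); specialize (Hd2 s Hs ltac:(lra)).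
  change (Rabs (f s - f t - (s - t) * l1) <= Rabs (l1 - l2) / 3 * Rabs (s - t)) in Hd1.
  change (Rabs (f s - f t - (s - t) * l2) <= Rabs (l1 - l2) / 3 * Rabs (s - t)) in Hd2.
  pose proof (Rabs_triang_inv (f s - f t - (s - t) * l2) (f s - f t - (s - t) * l1)) as Htri.
  pose proof (Rabs_triang (f s - f t - (s - t) * l2) (- (f s - f t - (s - t) * l1))) as Htri'.
  rewrite Rabs_Ropp in Htri'.
  replace (f s - f t - (s - t) * l2 + - (f s - f t - (s - t) * l1))
    with ((s - t) * (l1 - l2)) in Htri' by ring.
  rewrite Rabs_mult, Es in Htri'; rewrite Es in Hd1, Hd2.
  assert (0 < Rabs (l1 - l2)) by lra. nra.
Qed.

Lemma is_derive_on_linear_comb (T t : R) (n : nat) (a : nat -> R) (f : nat -> R -> R)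
    (l : nat -> R) :
  (forall j, (1 <= j <= n)%nat -> is_derive_on T (f j) t (l j)) ->
  is_derive_on T (fun s => sum1 (fun j => a j * f j s) n) t (sum1 (fun j => a j * l j) n).
Proof.
  unfold is_derive_on.
  induction n as [|n IH]; intros H.
  - apply filterdiff_ext_lin with (fun _ => 0); [|intros; rewrite sum1_0; symmetry; apply Rmult_0_r].
    apply filterdiff_ext with (fun _ => 0); [intros; rewrite sum1_0; reflexivity|].
    exact (filterdiff_const (V := R_NormedModule) 0).
  - apply filterdiff_ext_lin with
      (fun s : R => plus (scal s (sum1 (fun j => a j * l j) n)) (scal (a (S n)) (scal s (l (S n))))).
    + apply filterdiff_ext with
        (fun s : R => plus (sum1 (fun j => a j * f j s) n) (scal (a (S n)) (f (S n) s)));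
        [intros; rewrite sum1_S; reflexivity|].
      apply (filterdiff_plus_fct (U := R_NormedModule) (V := R_NormedModule)
        (fun s => sum1 (fun j => a j * f j s) n) (fun s => scal (a (S n)) (f (S n) s))
        (fun s => scal s (sum1 (fun j => a j * l j) n))
        (fun s => scal (a (S n)) (scal s (l (S n))))).
      * apply IH; intros; apply H; lia.
      * apply (filterdiff_scal_r_fct (U := R_NormedModule) (V := R_NormedModule)
          (a (S n)) (f (S n)) (fun s => scal s (l (S n)))); [intros; apply Rmult_comm|].
        apply H; lia.
    + intros s; rewrite sum1_S.
      change (s * sum1 (fun j => a j * l j) n + a (S n) * (s * l (S n))
        = s * (sum1 (fun j => a j * l j) n + a (S n) * l (S n))); ring.
Qed.

Lemma is_derive_is_derive_on (T : R) (f g : R -> R) (t l : R) :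
  0 <= t <= T -> (forall s, 0 <= s <= T -> f s = g s) ->
  is_derive f t l -> is_derive_on T g t l.
Proof.
  intros Ht Hfg [_ Hf]; apply (is_derive_on_epsilon (V := R_NormedModule) T g t l Ht).
  intros eps; destruct (Hf t) with (eps := eps) as [d Hd]; [intros P HP; exact HP|].
  exists d; intros s Hs Hst; rewrite <- !Hfg by assumption.
  apply Hd, Hst.
Qed.

Definition clamp (T s : R) : R := Rmax 0 (Rmin s T).

(** Outside [0, T] this is the tangent at the nearer end point, which turns
    one-sided derivatives into ordinary ones. *)
Definition extend (T : R) (f df : R -> R) (s : R) : R :=
  f (clamp T s) + (s - clamp T s) * df (clamp T s).

Lemma clamp_id (T s : R) : 0 <= s <= T -> clamp T s = s.
Proof. intros Hs; unfold clamp; rewrite Rmin_left, Rmax_right; lra. Qed.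

Lemma extend_eq (T : R) (f df : R -> R) (s : R) :
  0 <= s <= T -> extend T f df s = f s.
Proof. intros Hs; unfold extend; rewrite clamp_id by exact Hs; ring. Qed.

Lemma is_derive_extend (T : R) (f df : R -> R) (t : R) :
  0 < T -> 0 <= t <= T -> is_derive_on T f t (df t) ->
  is_derive (extend T f df) t (df t).
Proof.
  intros HT Ht H; pose proof (proj1 (is_derive_on_epsilon (V := R_NormedModule) T f t (df t) Ht) H) as K.
  split; [exact (is_linear_scal_l (K := R_AbsRing) (df t))|].
  intros x Hx eps; apply (is_filter_lim_locally_unique (V := R_NormedModule)) in Hx; subst x.
  destruct (K eps) as [d Hd].
  (* within [r] of [t] the interval can only be left through [t] itself *)
  assert (exists r : posreal, r <= d /\ (0 < t -> r <= t) /\ (t < T -> r <= T - t))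
    as [r [Hr1 [Hr2 Hr3]]].
  { assert (Hp : 0 < Rmin d (Rmin (if Rlt_dec 0 t then t else 1)
                               (if Rlt_dec t T then T - t else 1))).
    { destruct d as [d Pd]; cbn.
      destruct (Rlt_dec 0 t), (Rlt_dec t T); repeat apply Rmin_glb_lt; lra. }
    exists (mkposreal _ Hp); cbn; repeat split.
    - apply Rmin_l.
    - intros h; eapply Rle_trans; [apply Rmin_r|].
      eapply Rle_trans; [apply Rmin_l|]. destruct (Rlt_dec 0 t); lra.
    - intros h; eapply Rle_trans; [apply Rmin_r|].
      eapply Rle_trans; [apply Rmin_r|]. destruct (Rlt_dec t T); lra. }
  exists r; intros s Hs; change (Rabs (s - t) < r) in Hs.
  change (Rabs (extend T f df s - extend T f df t - (s - t) * df t) <= eps * Rabs (s - t)).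
  rewrite (extend_eq T f df t) by exact Ht.
  destruct (Rle_dec 0 s) as [H0|H0]; [destruct (Rle_dec s T) as [H1|H1]|].
  - rewrite extend_eq by lra; apply Hd; lra.
  - assert (E : t = T).
    { destruct (Req_dec t T) as [E|E]; [exact E|].
      pose proof (Hr3 ltac:(lra)); apply Rabs_def2 in Hs; lra. }
    replace (extend T f df s) with (f t + (s - t) * df t).
    + replace (f t + (s - t) * df t - f t - (s - t) * df t) with 0 by ring.
      rewrite Rabs_R0; apply Rmult_le_pos; [apply Rlt_le, cond_pos | apply Rabs_pos].
    + unfold extend, clamp; rewrite Rmin_right, Rmax_right by lra; rewrite E; reflexivity.
  - assert (E : t = 0).
    { destruct (Req_dec t 0) as [E|E]; [exact E|].
      pose proof (Hr2 ltac:(lra)); apply Rabs_def2 in Hs; lra. }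
    replace (extend T f df s) with (f t + (s - t) * df t).
    + replace (f t + (s - t) * df t - f t - (s - t) * df t) with 0 by ring.
      rewrite Rabs_R0; apply Rmult_le_pos; [apply Rlt_le, cond_pos | apply Rabs_pos].
    + unfold extend, clamp; rewrite Rmin_left, Rmax_left by lra; rewrite E; reflexivity.
Qed.

(** * Calculus along the flow *)

(** Uniform modulus of continuity of the arc cosine, from
    [1 - cos (|p - r|) <= |cos p - cos r|] on [0, PI]. It covers the end points
    of [-1, 1], where the arc cosine is not differentiable. *)
Lemma acos_modulus (eps x y : R) :
  0 < eps <= PI -> -1 <= x <= 1 -> -1 <= y <= 1 ->
  Rabs (x - y) < 1 - cos eps -> Rabs (acos x - acos y) < eps.
Proof.
  intros He.
  assert (W : forall a b, -1 <= a <= 1 -> -1 <= b <= 1 -> acos b <= acos a ->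
             Rabs (a - b) < 1 - cos eps -> acos a - acos b < eps).
  { intros a b Ha Hb Hab Hd.
    pose proof (acos_bound a) as Ba; pose proof (acos_bound b) as Bb.
    rewrite <- (cos_acos a Ha), <- (cos_acos b Hb) in Hd.
    set (p := acos a) in *; set (r := acos b) in *.
    apply Rnot_le_lt; intros Hn.
    assert (H1 : cos (p - r) <= cos eps).
    { destruct (Req_dec (p - r) eps) as [->|h]; [lra|].
      apply Rlt_le, cos_decreasing_1; lra. }
    assert (H2 : 1 - cos (p - r) <= cos r - cos p).
    { set (u := (p - r) / 2); set (w := (p + r) / 2).
      replace p with (w + u) by (unfold u, w; field).
      replace r with (w - u) by (unfold u, w; field).
      replace (w + u - (w - u)) with (2 * u) by ring.
      rewrite cos_2a_sin, cos_plus, cos_minus.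
      assert (Hu : 0 <= sin u) by (apply sin_ge_0; unfold u; lra).
      assert (Hw : sin u <= sin w).
      { destruct (Rle_lt_dec w (PI / 2)) as [h|h].
        - apply sin_incr_1; unfold u, w in *; lra.
        - rewrite <- (sin_PI_x w); apply sin_incr_1; unfold u, w in *; lra. }
      nra. }
    rewrite Rabs_minus_sym in Hd; pose proof (Rle_abs (cos r - cos p)); lra. }
  intros Hx Hy Hd; destruct (Rle_lt_dec (acos y) (acos x)) as [h|h].
  - rewrite Rabs_right by lra; apply W; assumption.
  - rewrite Rabs_left by lra.
    pose proof (W y x Hy Hx ltac:(lra)); rewrite Rabs_minus_sym in Hd; lra.
Qed.

Lemma is_derive_acos (x : R) : -1 < x < 1 -> is_derive acos x (- / sqrt (1 - x * x)).
Proof.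
  intros Hx; apply is_derive_Reals.
  replace (- / sqrt (1 - x * x)) with (derive_pt acos x (derivable_pt_acos x Hx)).
  - exact (proj2_sig (derivable_pt_acos x Hx)).
  - rewrite derive_pt_acos; unfold Rsqr, Rdiv; ring.
Qed.

Lemma is_derive_norm2 (f g : R -> R) (t df dg : R) :
  is_derive f t df -> is_derive g t dg -> 0 < f t * f t + g t * g t ->
  is_derive (fun s => sqrt (f s * f s + g s * g s)) t
    ((f t * df + g t * dg) / sqrt (f t * f t + g t * g t)).
Proof.
  intros Hf Hg Hp; auto_derive.
  - repeat split; try (exists df; exact Hf); try (exists dg; exact Hg); exact Hp.
  - change (Derive (fun x => f x) t) with (Derive f t).
    change (Derive (fun x => g x) t) with (Derive g t).
    rewrite (is_derive_unique _ _ _ Hf), (is_derive_unique _ _ _ Hg).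
    pose proof (sqrt_lt_R0 _ Hp); field; lra.
Qed.

(** The mean value theorem may return an end point, at which [df] is not
    controlled: this is why its proof truncates [df] at zero. *)
Lemma monotone_of_derive_ge0 (f df : R -> R) (a b : R) :
  a <= b ->
  (forall s, a < s < b -> is_derive f s (df s)) ->
  (forall s, a < s < b -> 0 <= df s) ->
  (forall s, a <= s <= b -> continuity_pt f s) ->
  f a <= f b.
Proof.
  intros Hab Hd H0 Hc.
  destruct (MVT_gen f a b (fun s => Rmax 0 (df s))) as [c [_ E]];
    rewrite ?Rmin_left, ?Rmax_right by exact Hab.
  - intros s Hs; rewrite Rmax_right by (apply H0, Hs); apply Hd, Hs.
  - exact Hc.
  - pose proof (Rmax_l 0 (df c)); nra.
Qed.

(** Applied to the supremum of the [t] such that [P] holds on [0, t]. *)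
Lemma real_induction (T : R) (P : R -> Prop) :
  P 0 ->
  (forall t, 0 <= t < T -> P t -> exists d : posreal, forall s, t <= s < t + d -> P s) ->
  (forall t, 0 < t <= T -> (forall s, 0 <= s < t -> P s) -> P t) ->
  forall t, 0 <= t <= T -> P t.
Proof.
  intros P0 Hopen Hclosed t0 Ht0; apply NNPP; intros Hn.
  pose (E := fun t => 0 <= t <= t0 /\ forall s, 0 <= s <= t -> P s).
  destruct (completeness E) as [m [Hub Hlub]].
  - exists t0; intros t [Ht _]; lra.
  - exists 0; split; [lra|]; intros s Hs; replace s with 0 by lra; exact P0.
  - assert (Hm : 0 <= m <= t0).
    { split; [|apply Hlub; intros t [Ht _]; lra].
      apply Hub; split; [lra|]; intros s Hs; replace s with 0 by lra; exact P0. }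
    assert (Hbelow : forall s, 0 <= s < m -> P s).
    { intros s Hs; apply NNPP; intros Hs'.
      apply (Rlt_not_le m s (proj2 Hs)), Hlub; intros t [Ht Hall].
      apply Rnot_lt_le; intros Hst; apply Hs', Hall; lra. }
    assert (Pm : P m).
    { destruct (Req_dec m 0) as [->|Hm0]; [exact P0|].
      apply Hclosed; [lra | exact Hbelow]. }
    assert (Hmt : m < t0).
    { destruct (Req_dec m t0) as [->|h]; [contradiction | lra]. }
    destruct (Hopen m ltac:(lra) Pm) as [d Hd].
    pose (m' := Rmin t0 (m + d / 2)); pose proof (cond_pos d) as Pd.
    assert (Hm' : m < m') by (apply Rmin_glb_lt; lra).
    apply (Rlt_not_le m' m Hm'), Hub; split.
    + pose proof (Rmin_l t0 (m + d / 2)); unfold m' in *; lra.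
    + intros s Hs; destruct (Rlt_le_dec s m) as [h|h]; [apply Hbelow; lra|].
      apply Hd; pose proof (Rmin_r t0 (m + d / 2)); unfold m' in *; lra.
Qed.

Lemma is_derive_sum1 (n : nat) (f : nat -> R -> R) (t : R) (l : nat -> R) :
  (forall k, is_derive (f k) t (l k)) ->
  is_derive (fun s => sum1 (fun k => f k s) n) t (sum1 l n).
Proof.
  intros H; induction n as [|n IH].
  - apply is_derive_ext with (fun _ => 0); [intros; symmetry; apply sum1_0|].
    rewrite sum1_0; apply (is_derive_const (V := R_NormedModule)).
  - apply is_derive_ext with (fun s => sum1 (fun k => f k s) n + f (S n) s);
      [intros; symmetry; apply sum1_S|].
    rewrite sum1_S; apply (is_derive_plus (V := R_NormedModule)); [exact IH | apply H].
Qed.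

Lemma continuity_pt_sum1 (n : nat) (f : nat -> R -> R) (t : R) :
  (forall k, continuity_pt (f k) t) -> continuity_pt (fun s => sum1 (fun k => f k s) n) t.
Proof.
  intros H; induction n as [|n IH].
  - apply continuity_pt_ext with (fun _ => 0); [intros; symmetry; apply sum1_0|].
    apply continuity_pt_const; intros x y; reflexivity.
  - apply continuity_pt_ext with (fun s => sum1 (fun k => f k s) n + f (S n) s);
      [intros; symmetry; apply sum1_S|].
    apply continuity_pt_plus; [exact IH | apply H].
Qed.

Lemma continuity_pt_eps (f : R -> R) (t : R) :
  continuity_pt f t ->
  forall e : posreal, locally t (fun s => Rabs (f s - f t) < e).
Proof. intros H e; apply continuity_pt_locally, H. Qed.

Section EvolvingPolygon.
Variables (N : nat) (T : R) (Z V : nat -> R -> R * R).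
Let curve (t : R) (k : nat) : R * R := Z k t.
Let velocity (t : R) (k : nat) : R * R := V k t.
Hypothesis HN : (3 <= N)%nat.
Hypothesis HT : 0 < T.
Hypothesis HZ : forall t, periodic_idx N (curve t).
Hypothesis HV : forall t, periodic_idx N (velocity t).
Hypothesis Hfst : forall k t, 0 <= t <= T -> is_derive (fun s => fst (Z k s)) t (fst (V k t)).
Hypothesis Hsnd : forall k t, 0 <= t <= T -> is_derive (fun s => snd (Z k s)) t (snd (V k t)).
Hypothesis Hlen : forall k t, 0 <= t <= T -> 0 < edge_len (curve t) k.
Hypothesis Hode : forall t, 0 <= t <= T -> vertex_ode N (curve t) (velocity t).

Let rate (t : R) (k : nat) : R := angular_velocity (curve t) (velocity t) k.

Lemma is_derive_edge_fst (k : nat) (t : R) :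
  0 <= t <= T -> is_derive (fun s => fst (edge (curve s) k)) t (fst (edge (velocity t) k)).
Proof.
  intros Ht; apply (is_derive_minus (V := R_NormedModule) (fun s => fst (Z (S k) s))
    (fun s => fst (Z k s))); apply Hfst, Ht.
Qed.

Lemma is_derive_edge_snd (k : nat) (t : R) :
  0 <= t <= T -> is_derive (fun s => snd (edge (curve s) k)) t (snd (edge (velocity t) k)).
Proof.
  intros Ht; apply (is_derive_minus (V := R_NormedModule) (fun s => snd (Z (S k) s))
    (fun s => snd (Z k s))); apply Hsnd, Ht.
Qed.

Lemma tangent_fst (t : R) (k : nat) :
  fst (tangent (curve t) k) = fst (edge (curve t) k) / edge_len (curve t) k.
Proof. apply Rmult_comm. Qed.

Lemma tangent_snd (t : R) (k : nat) :
  snd (tangent (curve t) k) = snd (edge (curve t) k) / edge_len (curve t) k.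
Proof. apply Rmult_comm. Qed.

Lemma is_derive_edge_len (k : nat) (t : R) :
  0 <= t <= T ->
  is_derive (fun s => edge_len (curve s) k) t
    (dot (tangent (curve t) k) (edge (velocity t) k)).
Proof.
  intros Ht; pose proof (Hlen k t Ht) as Hp.
  assert (E : forall s, edge_len (curve s) k
    = sqrt (fst (edge (curve s) k) * fst (edge (curve s) k)
            + snd (edge (curve s) k) * snd (edge (curve s) k)))
    by (intros s; apply norm_pair).
  apply is_derive_ext with (1 := fun s => eq_sym (E s)).
  unfold dot; rewrite tangent_fst, tangent_snd.
  evar_last.
  - apply is_derive_norm2; [apply is_derive_edge_fst, Ht | apply is_derive_edge_snd, Ht|].
    change (0 < dot (edge (curve t) k) (edge (curve t) k)); rewrite <- norm_pair_sq.
    apply Rmult_lt_0_compat; exact Hp.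
  - replace (sqrt _) with (edge_len (curve t) k) by apply E.
    revert Hp; generalize (edge_len (curve t) k), (edge (curve t) k), (edge (velocity t) k).
    intros q [a b] [a' b'] Hp; cbn; field; lra.
Qed.

(** The component of the edge velocity along the tangent only changes the
    length; the normal one, divided by the length, turns the tangent. *)
Lemma is_derive_tangent_fst (k : nat) (t : R) :
  0 <= t <= T ->
  is_derive (fun s => fst (tangent (curve s) k)) t
    (- (rate t k * snd (tangent (curve t) k))).
Proof.
  intros Ht; pose proof (Hlen k t Ht) as Hp.
  pose proof (tangent_unit (curve t) k Hp) as Hu.
  apply is_derive_ext with (1 := fun s => eq_sym (tangent_fst s k)).
  evar_last.
  - apply (is_derive_div (fun s => fst (edge (curve s) k)) (fun s => edge_len (curve s) k));
      [apply is_derive_edge_fst, Ht | apply is_derive_edge_len, Ht | lra].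
  - change (rate t k) with (cross (tangent (curve t) k) (edge (velocity t) k)
                             / edge_len (curve t) k).
    replace (fst (edge (curve t) k)) with (edge_len (curve t) k * fst (tangent (curve t) k))
      by (rewrite tangent_fst; field; lra).
    revert Hu Hp; generalize (edge_len (curve t) k), (tangent (curve t) k), (edge (velocity t) k).
    intros q [u1 u2] [e1 e2] Hu Hp; unfold dot, cross in *; cbn in *.
    apply Rmult_eq_reg_l with q; [|lra].
    transitivity (e1 - u1 * (u1 * e1 + u2 * e2)); [field; lra|].
    transitivity (- ((u1 * e2 - u2 * e1) * u2)); [|field; lra].
    replace e1 with ((u1 * u1 + u2 * u2) * e1) at 1 by (rewrite Hu; ring); ring.
Qed.

Lemma is_derive_tangent_snd (k : nat) (t : R) :
  0 <= t <= T ->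
  is_derive (fun s => snd (tangent (curve s) k)) t
    (rate t k * fst (tangent (curve t) k)).
Proof.
  intros Ht; pose proof (Hlen k t Ht) as Hp.
  pose proof (tangent_unit (curve t) k Hp) as Hu.
  apply is_derive_ext with (1 := fun s => eq_sym (tangent_snd s k)).
  evar_last.
  - apply (is_derive_div (fun s => snd (edge (curve s) k)) (fun s => edge_len (curve s) k));
      [apply is_derive_edge_snd, Ht | apply is_derive_edge_len, Ht | lra].
  - change (rate t k) with (cross (tangent (curve t) k) (edge (velocity t) k)
                             / edge_len (curve t) k).
    replace (snd (edge (curve t) k)) with (edge_len (curve t) k * snd (tangent (curve t) k))
      by (rewrite tangent_snd; field; lra).
    revert Hu Hp; generalize (edge_len (curve t) k), (tangent (curve t) k), (edge (velocity t) k).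
    intros q [u1 u2] [e1 e2] Hu Hp; unfold dot, cross in *; cbn in *.
    apply Rmult_eq_reg_l with q; [|lra].
    transitivity (e2 - u2 * (u1 * e1 + u2 * e2)); [field; lra|].
    transitivity ((u1 * e2 - u2 * e1) * u1); [|field; lra].
    replace e2 with ((u1 * u1 + u2 * u2) * e2) at 1 by (rewrite Hu; ring); ring.
Qed.

Lemma is_derive_turn_cos (k : nat) (t : R) :
  0 <= t <= T ->
  is_derive (fun s => dot (tangent (curve s) k) (tangent (curve s) (S k))) t
    (- (turn_sin (curve t) k * (rate t (S k) - rate t k))).
Proof.
  intros Ht.
  pose proof (is_derive_tangent_fst k t Ht) as F1; pose proof (is_derive_tangent_snd k t Ht) as F2.
  pose proof (is_derive_tangent_fst (S k) t Ht) as G1; pose proof (is_derive_tangent_snd (S k) t Ht) as G2.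
  unfold dot; evar_last.
  - apply (is_derive_plus (V := R_NormedModule)
      (fun s => fst (tangent (curve s) k) * fst (tangent (curve s) (S k)))
      (fun s => snd (tangent (curve s) k) * snd (tangent (curve s) (S k))));
      apply (is_derive_mult (K := R_AbsRing)); try eassumption; intros; apply Rmult_comm.
  - unfold turn_sin, cross, plus, mult; cbn; ring.
Qed.

Lemma continuity_turn_sin (k : nat) (t : R) :
  0 <= t <= T -> continuity_pt (fun s => turn_sin (curve s) k) t.
Proof.
  intros Ht.
  assert (F : forall j, continuity_pt (fun s => fst (tangent (curve s) j)) t).
  { intros j; apply ex_derive_continuity_pt; eexists; exact (is_derive_tangent_fst j t Ht). }
  assert (G : forall j, continuity_pt (fun s => snd (tangent (curve s) j)) t).
  { intros j; apply ex_derive_continuity_pt; eexists; exact (is_derive_tangent_snd j t Ht). }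
  apply (continuity_pt_minus
    (fun s => fst (tangent (curve s) k) * snd (tangent (curve s) (S k)))
    (fun s => snd (tangent (curve s) k) * fst (tangent (curve s) (S k)))).
  - exact (continuity_pt_mult _ _ t (F k) (G (S k))).
  - exact (continuity_pt_mult _ _ t (G k) (F (S k))).
Qed.

Lemma continuity_edge_len (k : nat) (t : R) :
  0 <= t <= T -> continuity_pt (fun s => edge_len (curve s) k) t.
Proof.
  intros Ht; apply ex_derive_continuity_pt; eexists; apply is_derive_edge_len, Ht.
Qed.

Lemma edge_len_gt0_locally (k : nat) (t : R) :
  0 <= t <= T -> locally t (fun s => 0 < edge_len (curve s) k).
Proof.
  intros Ht; pose proof (Hlen k t Ht) as Hp.
  generalize (continuity_pt_eps _ t (continuity_edge_len k t Ht) (mkposreal _ Hp)).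
  apply filter_imp; intros s Hs; cbn [pos] in Hs; apply Rabs_def2 in Hs; lra.
Qed.

Lemma continuity_turn_angle (k : nat) (t : R) :
  0 <= t <= T -> continuity_pt (fun s => turn_angle (curve s) k) t.
Proof.
  intros Ht; apply continuity_pt_locally; intros eps.
  set (e := Rmin eps PI).
  assert (He : 0 < e <= PI).
  { split; [apply Rmin_glb_lt; [apply cond_pos | apply PI_RGT_0] | apply Rmin_r]. }
  assert (Hd : 0 < 1 - cos e).
  { pose proof (cos_decreasing_1 0 e ltac:(lra) ltac:(lra) ltac:(lra) ltac:(lra) ltac:(lra)).
    rewrite cos_0 in *; lra. }
  assert (Hc : continuity_pt (fun s => dot (tangent (curve s) k) (tangent (curve s) (S k))) t)
    by (apply ex_derive_continuity_pt; eexists; apply is_derive_turn_cos, Ht).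
  generalize (continuity_pt_eps _ t Hc (mkposreal _ Hd)), (edge_len_gt0_locally k t Ht),
    (edge_len_gt0_locally (S k) t Ht); intros L1 L2 L3.
  generalize (filter_and _ _ L1 (filter_and _ _ L2 L3)); apply filter_imp.
  intros s [D1 [D2 D3]]; apply Rlt_le_trans with e; [|apply Rmin_l].
  apply acos_modulus; [exact He | | | exact D1]; apply dot_unit_bound; apply tangent_unit;
    try assumption; apply Hlen, Ht.
Qed.

Lemma is_derive_turn_angle (k : nat) (t : R) :
  0 <= t <= T -> 0 < turn_sin (curve t) k ->
  is_derive (fun s => turn_angle (curve s) k) t (rate t (S k) - rate t k).
Proof.
  intros Ht Hs.
  pose proof (tangent_unit _ _ (Hlen k t Ht)) as U1.
  pose proof (tangent_unit _ _ (Hlen (S k) t Ht)) as U2.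
  pose proof (lagrange_unit _ _ U1 U2) as HL.
  change (cross (tangent (curve t) k) (tangent (curve t) (S k)))
    with (turn_sin (curve t) k) in HL.
  evar_last.
  - apply (is_derive_comp acos (fun s => dot (tangent (curve s) k) (tangent (curve s) (S k))) t).
    + apply is_derive_acos; split; nra.
    + apply is_derive_turn_cos, Ht.
  - change (- (turn_sin (curve t) k * (rate t (S k) - rate t k))
      * - / sqrt (1 - dot (tangent (curve t) k) (tangent (curve t) (S k))
                      * dot (tangent (curve t) k) (tangent (curve t) (S k)))
      = rate t (S k) - rate t k).
    replace (1 - _) with (turn_sin (curve t) k * turn_sin (curve t) k) by lra.
    rewrite sqrt_square by lra; field; lra.
Qed.

(** * Strict convexity is preserved *)

(** Gronwall's argument: the angle times [exp (C * t)] is nondecreasing, where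
    [C] is finite because the edge lengths are bounded below on [0, T]. *)
Lemma turn_angle_stays_positive (t : R) (k : nat) :
  0 < t <= T -> (forall s j, 0 <= s < t -> 0 < turn_sin (curve s) j) ->
  0 < turn_angle (curve t) (S k).
Proof.
  intros Ht Hpos.
  pose (g := fun s => edge_len (curve s) (S k) * edge_len (curve s) (S (S k))).
  destruct (continuity_ab_min g 0 T ltac:(lra)) as [tm [Hmin Htm]].
  { intros s Hs; apply continuity_pt_mult; apply continuity_edge_len, Hs. }
  assert (Hm : 0 < g tm) by (apply Rmult_lt_0_compat; apply Hlen, Htm).
  pose (C := (2 + 2 * PI) / g tm).
  pose (th := fun s => turn_angle (curve s) (S k)).
  pose proof PI_RGT_0 as HPI.
  assert (H0 : 0 < th 0).
  { apply angle_interior; [apply tangent_unit, Hlen; lra .. | apply Hpos; lra]. }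
  assert (Hmono : th 0 * exp (C * 0) <= th t * exp (C * t)).
  { apply (monotone_of_derive_ge0 (fun s => th s * exp (C * s))
      (fun s => (rate s (S (S k)) - rate s (S k) + C * th s) * exp (C * s))); [lra| | |].
    - intros s Hs.
      assert (D : is_derive th s (rate s (S (S k)) - rate s (S k)))
        by (apply is_derive_turn_angle; [lra | apply Hpos; lra]).
      auto_derive; [exists (rate s (S (S k)) - rate s (S k)); exact D|].
      change (Derive (fun x => th x) s) with (Derive th s).
      rewrite (is_derive_unique _ _ _ D); ring.
    - intros s Hs; apply Rmult_le_pos; [|apply Rlt_le, exp_pos].
      pose proof (turn_rate_lower_bound N (curve s) (velocity s) HN (HZ s)
        (fun j => Hlen j s ltac:(lra)) (Hode s ltac:(lra)) k
        (fun j => Rlt_le _ _ (Hpos s j ltac:(lra)))) as Hrate.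
      fold (rate s (S k)) (rate s (S (S k))) (th s) (g s) in Hrate.
      assert (Hth : 0 <= th s) by apply angle_bounds.
      assert (HC : (2 + 2 * PI) / g s <= C).
      { apply Rmult_le_compat_l; [lra|]; apply Rinv_le_contravar; [exact Hm|].
        apply Hmin; lra. }
      pose proof (Rmult_le_compat_r _ _ _ Hth HC); lra.
    - intros s Hs; apply continuity_pt_mult; [apply continuity_turn_angle; lra|].
      apply ex_derive_continuity_pt; auto_derive; trivial. }
  rewrite Rmult_0_r, exp_0 in Hmono; pose proof (exp_pos (C * t)).
  apply Rnot_le_lt; intros Hn; fold (th t) in Hn; nra.
Qed.

(** The derivative of each angle is a difference of consecutive angular
    velocities, and these sum to zero over a period. *)
Lemma sum_turn_angles_constant (t : R) :
  0 <= t <= T -> (forall s j, 0 <= s < t -> 0 < turn_sin (curve s) j) ->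
  sum1 (turn_angle (curve t)) N = sum1 (turn_angle (curve 0)) N.
Proof.
  intros Ht Hpos.
  pose (f := fun s => sum1 (fun k => turn_angle (curve s) k) N).
  assert (Hd : forall s, 0 < s < t -> is_derive f s 0).
  { intros s Hs; evar_last.
    - apply (is_derive_sum1 N (fun k s => turn_angle (curve s) k)).
      intros k; apply is_derive_turn_angle; [lra | apply Hpos; lra].
    - rewrite sum1_minus, (sum1_succ N (rate s)); [ring|].
      intros k; unfold rate, angular_velocity.
      rewrite <- Nat.add_succ_l, !HV, (tangent_periodic N _ (HZ s)), (edge_len_periodic N _ (HZ s)).
      reflexivity. }
  assert (Hc : forall s, 0 <= s <= t -> continuity_pt f s).
  { intros s Hs; apply continuity_pt_sum1; intros k; apply continuity_turn_angle; lra. }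
  apply Rle_antisym.
  - apply Ropp_le_cancel.
    apply (monotone_of_derive_ge0 (fun s => - f s) (fun _ => 0)); [lra| |intros; lra|].
    + intros s Hs; evar_last;
        [apply (is_derive_opp (V := R_NormedModule)), Hd, Hs | apply Ropp_0].
    + intros s Hs; apply continuity_pt_opp, Hc, Hs.
  - apply (monotone_of_derive_ge0 f (fun _ => 0)); [lra | exact Hd | intros; lra | exact Hc].
Qed.

Hypothesis Hinit : forall k, 0 < turn_sin (curve 0) k.
Hypothesis Hsum : sum1 (turn_angle (curve 0)) N = 2 * PI.

(** The property is open by continuity and periodicity. At the end [t] of an
    interval on which it holds, the angles are positive and below PI, which
    makes their sines positive. *)
Lemma turn_sin_stays_positive (t : R) :
  0 <= t <= T -> forall k, 0 < turn_sin (curve t) k.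
Proof.
  revert t; apply (real_induction T (fun t => forall k, 0 < turn_sin (curve t) k)).
  - exact Hinit.
  - intros t Ht Hpos.
    assert (Hloc : locally t (fun s => forall k, (k < N)%nat -> 0 < turn_sin (curve s) k)).
    { generalize N; intros n; induction n as [|n IH]; [apply filter_forall; intros; lia|].
      generalize (continuity_pt_eps _ t (continuity_turn_sin n t ltac:(lra))
                    (mkposreal _ (Hpos n))); intros Hn.
      generalize (filter_and _ _ IH Hn); apply filter_imp; intros s [H1 H2] k Hk.
      destruct (Nat.eq_dec k n) as [->|h]; [|apply H1; lia].
      cbn [pos] in H2; apply Rabs_def2 in H2; lra. }
    destruct Hloc as [d Hd]; exists d; intros s Hs k.
    destruct (periodic_reduce_lt N _ k ltac:(lia) (turn_sin_periodic N _ (HZ s))) as [j [Hj ->]].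
    apply Hd; [|exact Hj].
    change (Rabs (s - t) < d); rewrite Rabs_right; lra.
  - intros t Ht Hpos'.
    assert (Hpos : forall s j, 0 <= s < t -> 0 < turn_sin (curve s) j)
      by (intros s j Hs; apply Hpos', Hs).
    assert (Hth : forall k, 0 < turn_angle (curve t) k).
    { intros k; rewrite <- (turn_angle_periodic N _ (HZ t)).
      replace (k + N)%nat with (S (k + (N - 1))) by lia.
      apply turn_angle_stays_positive; assumption. }
    assert (Hge : forall k, 0 <= turn_sin (curve t) k).
    { intros k; apply Rnot_lt_le; intros Hneg.
      assert (He : 0 < - turn_sin (curve t) k) by lra.
      destruct (continuity_pt_eps _ t (continuity_turn_sin k t ltac:(lra)) (mkposreal _ He))
        as [d Hd].
      pose (s := Rmax 0 (t - d / 2)); pose proof (cond_pos d) as Pd.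
      assert (Hs : 0 <= s < t /\ t - d / 2 <= s).
      { unfold s; split; [split; [apply Rmax_l | apply Rmax_lub_lt; lra] | apply Rmax_r]. }
      specialize (Hd s ltac:(change (Rabs (s - t) < d); rewrite Rabs_left; lra)).
      cbn [pos] in Hd; apply Rabs_def2 in Hd; pose proof (Hpos s k (proj1 Hs)); lra. }
    assert (Hlt : forall k, turn_angle (curve t) k < PI).
    { apply (turn_angle_lt_PI N); [exact HN | apply HZ | | exact Hge | exact Hth |].
      - intros k; apply Hlen; lra.
      - rewrite sum_turn_angles_constant by (lra || exact Hpos); exact Hsum. }
    intros k; replace (turn_sin (curve t) k) with (sin (turn_angle (curve t) k)).
    + apply sin_gt_0; [apply Hth | apply Hlt].
    + apply sin_angle; [apply tangent_unit, Hlen; lra .. | apply Hge].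
Qed.

Lemma perimeter_decreases (t : R) :
  0 <= t <= T ->
  exists l, is_derive (fun s => perimeter N (curve s)) t l /\ l <= 0.
Proof.
  intros Ht; exists (sum1 (fun k => dot (tangent (curve t) k) (edge (velocity t) k)) N); split.
  - apply is_derive_ext with (fun s => sum1 (fun k => edge_len (curve s) k) N).
    + intros s; symmetry; apply perimeter_sum_edge_len, HZ.
    + apply (is_derive_sum1 N (fun k s => edge_len (curve s) k)).
      intros k; apply is_derive_edge_len, Ht.
  - apply (perimeter_rate_le0 N (curve t) (velocity t) HN (HZ t) (HV t)
      (fun k => Hlen k t Ht) (Hode t Ht)).
    + intros k; apply Rlt_le, turn_sin_stays_positive, Ht.
    + rewrite sum_turn_angles_constant; [exact Hsum | exact Ht|].
      intros s j Hs; apply turn_sin_stays_positive; lra.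
Qed.

End EvolvingPolygon.

(** * The semidiscrete solution *)

Lemma periodic_mod {A : Type} (N : nat) (f : nat -> A) (k : nat) :
  periodic_idx N f -> f (k mod N)%nat = f k.
Proof.
  intros Hf; rewrite (Nat.div_mod_eq k N) at 2.
  induction (k / N)%nat as [|m IH]; [rewrite Nat.mul_0_r; reflexivity|].
  rewrite IH, <- Hf; f_equal; lia.
Qed.

Section Solution.
Variables (N : nat) (xi : nat -> R) (phi : nat -> R -> R) (X0 : R -> R * R) (T : R)
  (X : nat -> R -> R * R).
Hypothesis HN : (3 <= N)%nat.
Hypothesis Hxi : is_partition N xi.
Hypothesis Hphi : is_nodal_basis N xi phi.
Hypothesis HT : 0 < T.
Hypothesis Hsol : semidiscrete_solution N xi phi X0 T X.
Hypothesis Hlen : forall j t, (1 <= j <= N)%nat -> 0 <= t <= T ->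
  0 < edge_length (fun i => X i t) j.

Lemma solution_edge_len_gt0 (k : nat) (t : R) :
  0 <= t <= T -> 0 < edge_len (fun i => X i t) k.
Proof.
  intros Ht; destruct Hsol as [HX _].
  destruct (periodic_reduce_lt N _ k ltac:(lia) (edge_len_periodic N _ (HX t))) as [j [Hj ->]].
  pose proof (Hlen (S j) t ltac:(lia) Ht) as H; unfold edge_length in H.
  replace (S j - 1)%nat with j in H by lia; exact H.
Qed.

(** The solution is differentiable at the nodes, hence so are the vertices. By
    uniqueness of derivatives, [dtX] at a fixed time is then the finite element
    function with the vertex velocities as nodal values, as
    [vertex_ode_of_weak_form] requires. *)
Lemma solution_vertex_ode :
  exists V : nat -> R -> R * R,
    (forall t, periodic_idx N (fun k => V k t)) /\
    (forall k t, 0 <= t <= T -> is_derive_on T (X k) t (V k t)) /\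
    (forall t, 0 <= t <= T -> vertex_ode N (fun k => X k t) (fun k => V k t)).
Proof.
  pose proof solution_edge_len_gt0 as Hq.
  destruct Hsol as [HX [_ [dtX [HdX Hweak]]]].
  (* the node [k mod N] is in the range of the partition for every [k] *)
  pose (V := fun k t => dtX (xi (k mod N)%nat) t).
  assert (HV : forall t, periodic_idx N (fun k => V k t)).
  { intros t k; unfold V; rewrite <- (Nat.Div0.mod_add k 1 N), Nat.mul_1_l; reflexivity. }
  assert (HXV : forall k t, 0 <= t <= T -> is_derive_on T (X k) t (V k t)).
  { intros k t Ht; generalize (HdX (xi (k mod N)%nat) t Ht); apply filterdiff_ext; intros s.
    assert (Hk : (k mod N < N)%nat) by (apply Nat.mod_upper_bound; lia).
    rewrite (fe_comb_node N xi phi HN Hxi Hphi (fun j => X j s)) by (apply HX || lia).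
    apply (periodic_mod N (fun j => X j s) k (HX s)). }
  assert (E : forall t, 0 <= t <= T -> (fun x => dtX x t) = fe_comb N phi (fun k => V k t)).
  { intros t Ht; apply functional_extensionality; intros x.
    apply injective_projections; rewrite ?fst_fe_comb, ?snd_fe_comb.
    - apply (is_derive_on_unique T (fun s => fst (fe_comb N phi (fun j => X j s) x)) t); [exact HT | exact Ht | |].
      + apply is_derive_on_fst, HdX, Ht.
      + apply filterdiff_ext with (fun s => sum1 (fun j => phi j x * fst (X j s)) N);
          [intros s; symmetry; apply fst_fe_comb|].
        apply is_derive_on_linear_comb; intros j _; apply is_derive_on_fst, HXV, Ht.
    - apply (is_derive_on_unique T (fun s => snd (fe_comb N phi (fun j => X j s) x)) t); [exact HT | exact Ht | |].
      + apply is_derive_on_snd, HdX, Ht.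
      + apply filterdiff_ext with (fun s => sum1 (fun j => phi j x * snd (X j s)) N);
          [intros s; symmetry; apply snd_fe_comb|].
        apply is_derive_on_linear_comb; intros j _; apply is_derive_on_snd, HXV, Ht. }
  exists V; split; [exact HV | split; [exact HXV|]].
  intros t Ht.
  apply (vertex_ode_of_weak_form N xi phi HN Hxi Hphi _ _ (HX t) (HV t) (fun k => Hq k t Ht)).
  intros v Hv; rewrite <- E by exact Ht; exact (Hweak t Ht v Hv).
Qed.

End Solution.

(** * Decrease of the perimeter *)

Theorem theorem2p4 :
  forall (N : nat) (xi : nat -> R) (phi : nat -> R -> R) (X0 : R -> R * R)
    (T : R) (X : nat -> R -> R * R),
  (3 <= N)%nat ->
  is_partition N xi ->
  is_nodal_basis N xi phi ->
  periodic_fun X0 ->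
  (forall x, continuous X0 x) ->
  0 < T ->
  semidiscrete_solution N xi phi X0 T X ->
  convex_N_polygon N (fun j => X j 0) ->
  (forall j t, (1 <= j <= N)%nat -> 0 <= t <= T ->
     0 < edge_length (fun i => X i t) j) ->
  forall t, 0 <= t <= T ->
  exists l : R,
    is_derive_on T (fun s => perimeter N (fun j => X j s)) t l /\ l <= 0.
Proof.
  intros N xi phi X0 T X HN Hxi Hphi _ _ HT Hsol Hconv Hlen t Ht.
  destruct (solution_vertex_ode N xi phi X0 T X HN Hxi Hphi HT Hsol Hlen) as [V [HV [HXV Hode]]].
  pose proof (solution_edge_len_gt0 N xi phi X0 T X HN Hsol Hlen) as Hq.
  destruct Hsol as [HX _].
  destruct (convex_polygon_turns N _ HN (HX 0) Hconv) as [Hinit Hsum].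
  pose (Z := fun k s => (extend T (fun s => fst (X k s)) (fun s => fst (V k s)) s,
                         extend T (fun s => snd (X k s)) (fun s => snd (V k s)) s)).
  assert (EZ : forall s, 0 <= s <= T -> (fun k => Z k s) = (fun k => X k s)).
  { intros s Hs; apply functional_extensionality; intros k.
    apply injective_projections; apply extend_eq, Hs. }
  destruct (perimeter_decreases N T Z V) with (t := t) as [l [Hl Hl0]]; try assumption.
  - intros s k; unfold Z, extend; cbn [fst snd]. rewrite !HX, !HV; reflexivity.
  - intros k s Hs; apply is_derive_extend; [exact HT | exact Hs|].
    apply is_derive_on_fst, HXV, Hs.
  - intros k s Hs; apply is_derive_extend; [exact HT | exact Hs|].
    apply is_derive_on_snd, HXV, Hs.
  - intros k s Hs; rewrite EZ by exact Hs; apply Hq, Hs.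
  - intros s Hs; rewrite EZ by exact Hs; apply Hode, Hs.
  - intros k; rewrite EZ by lra; apply Hinit.
  - rewrite EZ by lra; exact Hsum.
  - exists l; split; [|exact Hl0].
    apply (is_derive_is_derive_on T (fun s => perimeter N (fun k => Z k s)));
      [exact Ht | intros s Hs; rewrite EZ by exact Hs; reflexivity | exact Hl].
Qed.
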